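(* Assume the Continuum Hypothesis. Let $X$ be a noncompact, locally compact, separable metrizable (topological) manifold. Then the Čech–Stone remainder $X^*=\beta X\setminus X$ has $2^{\mathfrak c}$-many homeomorphisms. In particular, $X^*$ has nontrivial homeomorphisms.
   Context: $\beta X$ is the Čech–Stone compactification of $X$ and $\mathfrak c=2^{\aleph_0}$. A homeomorphism $\phi$ of $X^*$ is trivial if there is a continuous map $f\colon X\to X$ such that $\phi=\beta f\restriction X^*$, where $\beta f\colon\beta X\to\beta X$ is the unique continuous extension of $f$. *)

(* Defs.v *)
From Stdlib Require Import Reals List.
From Stdlib Require Vectors.Fin.
Open Scope R_scope.
Set Implicit Arguments.

Definition opens (T : Type) := (T -> Prop) -> Prop.

Definition is_topology (T : Type) (t : opens T) : Prop :=
  t (fun _ => True) /\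
  (forall U V, t U -> t V -> t (fun x => U x /\ V x)) /\
  (forall F : (T -> Prop) -> Prop, (forall U, F U -> t U) ->
     t (fun x => exists U, F U /\ U x)).

Definition subspace (T : Type) (t : opens T) (A : T -> Prop) : opens {x | A x} :=
  fun V => exists U, t U /\ forall y : {x | A x}, V y <-> U (proj1_sig y).

Definition continuous (X Y : Type) (tX : opens X) (tY : opens Y) (f : X -> Y) : Prop :=
  forall V, tY V -> tX (fun x => V (f x)).

Definition homeomorphism (X Y : Type) (tX : opens X) (tY : opens Y) (f : X -> Y) : Prop :=
  continuous tX tY f /\
  exists g : Y -> X, continuous tY tX g /\ (forall x, g (f x) = x) /\ (forall y, f (g y) = y).

Definition compact_space (T : Type) (t : opens T) : Prop :=
  forall F : (T -> Prop) -> Prop,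
    (forall U, F U -> t U) -> (forall x, exists U, F U /\ U x) ->
    exists l : list (T -> Prop), (forall U, In U l -> F U) /\ (forall x, exists U, In U l /\ U x).

Definition hausdorff (T : Type) (t : opens T) : Prop :=
  forall x y, x <> y -> exists U V, t U /\ t V /\ U x /\ V y /\ (forall z, ~ (U z /\ V z)).

Definition dense (T : Type) (t : opens T) (A : T -> Prop) : Prop :=
  forall U, t U -> (exists x, U x) -> exists x, U x /\ A x.

Definition embedding (X Y : Type) (tX : opens X) (tY : opens Y) (e : X -> Y) : Prop :=
  continuous tX tY e /\ (forall x x', e x = e x' -> x = x') /\
  (forall U, tX U -> exists V, tY V /\ forall x, U x <-> V (e x)).

Definition is_StoneCech (X : Type) (tX : opens X) (K : Type) (tK : opens K) (e : X -> K) : Prop :=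
  is_topology tK /\ compact_space tK /\ hausdorff tK /\ embedding tX tK e /\
  dense tK (fun p => exists x, e x = p) /\
  (forall (Y : Type) (tY : opens Y), is_topology tY -> compact_space tY -> hausdorff tY ->
     forall f : X -> Y, continuous tX tY f ->
     exists g : K -> Y, continuous tK tY g /\ forall x, g (e x) = f x).

Definition remainder (X K : Type) (e : X -> K) : K -> Prop := fun p => ~ exists x, e x = p.
Definition Xstar (X K : Type) (e : X -> K) := {p : K | remainder e p}.
Definition Xstar_top (X K : Type) (tK : opens K) (e : X -> K) : opens (Xstar e) :=
  subspace tK (remainder e).
Arguments Xstar_top {X K} tK e.

(** φ : X^* -> X^* is trivial: φ = βf restricted to X^* for some continuous f : X -> X,
    where βf : βX -> βX is the continuous extension of e ∘ f. *)
Definition trivial_homeo (X K : Type) (tX : opens X) (tK : opens K) (e : X -> K)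
  (phi : Xstar e -> Xstar e) : Prop :=
  exists f : X -> X, continuous tX tX f /\
  exists g : K -> K, continuous tK tK g /\ (forall x, g (e x) = e (f x)) /\
    (forall p : Xstar e, g (proj1_sig p) = proj1_sig (phi p)).
Arguments trivial_homeo {X K} tX tK e phi.

(** Euclidean space R^n with its usual (product = sup-metric) topology. *)
Definition Rn (n : nat) := Fin.t n -> R.
Definition euclid_top (n : nat) : opens (Rn n) :=
  fun U => forall x, U x -> exists eps, 0 < eps /\
    forall y : Rn n, (forall i, Rabs (x i - y i) < eps) -> U y.
Arguments euclid_top : clear implicits.

Definition metrizable (X : Type) (tX : opens X) : Prop :=
  exists d : X -> X -> R,
    (forall x y, 0 <= d x y) /\ (forall x y, d x y = 0 <-> x = y) /\
    (forall x y, d x y = d y x) /\ (forall x y z, d x z <= d x y + d y z) /\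
    (forall U, tX U <-> forall x, U x -> exists eps, 0 < eps /\ forall y, d x y < eps -> U y).

Definition separable (X : Type) (tX : opens X) : Prop :=
  exists s : nat -> X, dense tX (fun x => exists k, s k = x).

Definition locally_compact (X : Type) (tX : opens X) : Prop :=
  forall x, exists (U C : X -> Prop), tX U /\ U x /\ (forall y, U y -> C y) /\
    compact_space (subspace tX C).

Definition locally_euclidean (X : Type) (tX : opens X) (n : nat) : Prop :=
  forall x, exists U, tX U /\ U x /\ exists V, euclid_top n V /\
    exists h : {y | U y} -> {v | V v},
      homeomorphism (subspace tX U) (subspace (euclid_top n) V) h.

Definition equipotent (A B : Type) : Prop :=
  exists f : A -> B, (forall a a', f a = f a' -> a = a') /\ (forall b, exists a, f a = b).

(** The Continuum Hypothesis: every subset of 2^ω (|2^ω| = 𝔠) is countable or of size 𝔠. *)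
Definition CH : Prop :=
  forall S : (nat -> bool) -> Prop,
    (exists f : {x | S x} -> nat, forall a a', f a = f a' -> a = a') \/
    equipotent {x | S x} (nat -> bool).

(* Main.v *)
(** The homeomorphisms are limits along a tower of length omega_1.

    Choose a discrete sequence of compact sets B_n in X and, on each of them, a large set of
    homeomorphisms of X supported in B_n: in positive dimension an isotopy inside a chart,
    parametrised by an interval; in dimension 0 all permutations of a finite set with N points.
    Such a set can be shrunk so that it decides a given disjoint pair of closed sets of X (no
    point of B_n is sent to the first set by one of its members and to the second by another), or
    split into two pieces moving some point of B_n to separated places.  An interval survives any
    number of such operations, and a set of permutations survives k of them as soon as it has
    4^(N k) elements, which N! exceeds for N large.

    Under CH the pairs of closed sets of X are enumerated along a well-order with countable initial
    segments.  A recursion along it produces sequences of sets of homeomorphisms, decreasing modulo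
    finite, the a-th of which decides the a-th pair; countable chains have lower bounds by
    diagonalisation, and at each step there are two separated continuations.  Picking one
    homeomorphism on each B_n and gluing gives homeomorphisms Phi_a of X whose extensions to
    the remainder converge, because every pair is decided from some stage on.  The limits are
    homeomorphisms of the remainder, and distinct branches give distinct limits, so there are
    2^c of them; on the other hand only c are trivial, since a continuous self-map of X
    is determined by its values on a countable dense set. *)

Require Import Defs.
From Stdlib Require Import Reals List Lra Lia Arith.Cantor Wellfounded.
From Stdlib Require Import Classical ClassicalEpsilon FunctionalExtensionality PropExtensionality.
From Stdlib Require Vectors.Fin.
From mathcomp Require all_boot all_fingroup boolp wochoice.
Set Implicit Arguments.
Unset Strict Implicit.

(** Everything holds modulo finitely many blocks B_n; these form a compact set, and no neighbourhood
    of a point of the remainder has its trace on [X] inside a compact set, so the error vanishes on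
    the remainder. Along the tower convergence must be uniform, as pointwise limits need be neither
    continuous nor invertible; therefore a decision compares two different members of a set, and
    their inverses as well. Disjoint closed pairs serve as test objects because in the compact
    Hausdorff [K] a neighbourhood contains the closure of a smaller one, and the traces on [X] of
    that closure and of the complement of the larger neighbourhood form such a pair. CH reconciles
    two demands: all continuum many pairs must be met, but the diagonalisation handles countable
    chains only. Norms must be unbounded along [n], since every stage consumes two rounds on almost
    every block. The upper bound 2^c is a separate count: a homeomorphism of the remainder is coded
    by a family of pairs of subsets of a countable dense set, and Cantor-Bernstein joins the two
    bounds. *)

Lemma pred_ext (T : Type) (U V : T -> Prop) : (forall x, U x <-> V x) -> U = V.
Proof.
  intros H. apply functional_extensionality. intros x.
  apply propositional_extensionality. apply H.
Qed.

Lemma list_choice (A B : Type) (P : A -> B -> Prop) (l : list A) :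
  (forall a, In a l -> exists b, P a b) ->
  exists l' : list B, (forall b, In b l' -> exists a, In a l /\ P a b) /\
                      (forall a, In a l -> exists b, In b l' /\ P a b).
Proof.
  induction l as [|a l IH]; intros H.
  - exists nil. split; simpl; tauto.
  - destruct IH as [l' [H1 H2]]. { intros; apply H; simpl; auto. }
    destruct (H a (or_introl eq_refl)) as [b Hb].
    exists (b :: l'). split.
    + intros c [<-|Hc]; [exists a; simpl; auto|].
      destruct (H1 c Hc) as [a' [? ?]]. exists a'. simpl; auto.
    + intros a' [<-|Ha]; [exists b; simpl; auto|].
      destruct (H2 a' Ha) as [b' [? ?]]. exists b'. simpl; auto.
Qed.

(** * Topological preliminaries *)

Definition closed (T : Type) (t : opens T) (A : T -> Prop) : Prop := t (fun x => ~ A x).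

Definition closure (T : Type) (t : opens T) (A : T -> Prop) : T -> Prop :=
  fun x => forall U, t U -> U x -> exists y, U y /\ A y.

Definition compact_set (T : Type) (t : opens T) (A : T -> Prop) : Prop :=
  forall F : (T -> Prop) -> Prop,
    (forall U, F U -> t U) -> (forall x, A x -> exists U, F U /\ U x) ->
    exists l : list (T -> Prop), (forall U, In U l -> F U) /\
                                 (forall x, A x -> exists U, In U l /\ U x).

Section Topology.
Variables (T : Type) (t : opens T).
Hypothesis Ht : is_topology t.

Lemma open_full : t (fun _ => True).
Proof. apply Ht. Qed.

Lemma open_inter U V : t U -> t V -> t (fun x => U x /\ V x).
Proof. apply Ht. Qed.

Lemma open_ext U V : t U -> (forall x, U x <-> V x) -> t V.
Proof. intros H E. now rewrite <- (pred_ext E). Qed.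

Lemma open_locally U :
  (forall x, U x -> exists V, t V /\ V x /\ (forall y, V y -> U y)) -> t U.
Proof.
  intros H. destruct Ht as [_ [_ Hu]].
  apply (@open_ext (fun x => exists V, (t V /\ forall y, V y -> U y) /\ V x)).
  - apply Hu. tauto.
  - intros x. split.
    + intros [V [[_ HV] HVx]]. auto.
    + intros Hx. destruct (H x Hx) as [V [? [? ?]]]. exists V; auto.
Qed.

Lemma open_const (P : Prop) : t (fun _ => P).
Proof. apply open_locally. intros x HP. exists (fun _ => True). split; [apply open_full|auto]. Qed.

Lemma open_union (F : (T -> Prop) -> Prop) :
  (forall U, F U -> t U) -> t (fun x => exists U, F U /\ U x).
Proof. apply Ht. Qed.

Lemma open_list_inter (l : list (T -> Prop)) :
  (forall U, In U l -> t U) -> t (fun x => forall U, In U l -> U x).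
Proof.
  induction l as [|U l IH]; intros H.
  - apply open_ext with (1 := open_full). simpl; tauto.
  - apply (@open_ext (fun x => U x /\ forall V, In V l -> V x)).
    + apply open_inter; [apply H; simpl; auto|apply IH; intros; apply H; simpl; auto].
    + intros x. simpl. split.
      * intros [H1 H2] V [<-|HV]; [exact H1|exact (H2 V HV)].
      * intros HH; split; [apply HH; auto|intros V HV; apply HH; auto].
Qed.

Lemma open_bounded_inter (U : nat -> T -> Prop) N :
  (forall n, (n < N)%nat -> t (U n)) -> t (fun x => forall n, (n < N)%nat -> U n x).
Proof.
  intros H. apply (@open_ext (fun x => forall V, In V (map U (seq 0 N)) -> V x)).
  - apply open_list_inter. intros V HV. apply in_map_iff in HV.
    destruct HV as [n [<- Hn]]. apply in_seq in Hn. apply H. lia.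
  - intros x. split.
    + intros HV n Hn. apply HV. apply in_map. apply in_seq. lia.
    + intros HU V HV. apply in_map_iff in HV. destruct HV as [n [<- Hn]].
      apply in_seq in Hn. apply HU. lia.
Qed.

Lemma open_diff U A : t U -> closed t A -> t (fun x => U x /\ ~ A x).
Proof. intros. now apply open_inter. Qed.

Lemma open_closed_compl U : t U -> closed t (fun x => ~ U x).
Proof.
  intros H. unfold closed. apply open_ext with (1 := H).
  intros x. split; [tauto|apply NNPP].
Qed.

Lemma closure_closed A : closed t (closure t A).
Proof.
  apply open_locally. intros x Hx. unfold closure in Hx.
  apply not_all_ex_not in Hx. destruct Hx as [U HU].
  exists U. split; [tauto|]. split; [tauto|].
  intros y Hy H. apply HU. intros HtU HUx. exact (H U HtU Hy).
Qed.

Lemma closure_incl A x : A x -> closure t A x.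
Proof. intros HA U _ HU. exists x; auto. Qed.

Lemma compact_space_set : compact_space t <-> compact_set t (fun _ => True).
Proof.
  split; intros H F HF Hc.
  - destruct (H F HF) as [l [H1 H2]]; [intros; now apply Hc|]. exists l; auto.
  - destruct (H F HF) as [l [H1 H2]]; [intros; now apply Hc|]. exists l; auto.
Qed.

Lemma compact_subspace A : compact_space (subspace t A) -> compact_set t A.
Proof.
  intros H F HF Hc.
  destruct (H (fun V => exists U, F U /\ V = fun y => U (proj1_sig y))) as [l [H1 H2]].
  - intros V [U [HU ->]]. exists U. split; [auto|tauto].
  - intros [x Hx]. destruct (Hc x Hx) as [U [? ?]].
    exists (fun y => U (proj1_sig y)). split; [exists U; auto|auto].
  - destruct (@list_choice _ _ (fun V U => F U /\ V = fun y => U (proj1_sig y)) l H1)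
      as [l' [H3 H4]].
    exists l'. split.
    + intros U HU. destruct (H3 U HU) as [V [_ [? _]]]. auto.
    + intros x Hx. destruct (H2 (exist _ x Hx)) as [V [HV HVx]].
      destruct (H4 V HV) as [U [HU [_ ->]]]. exists U; auto.
Qed.

Lemma compact_closed_subset A B :
  compact_set t A -> closed t B -> (forall x, B x -> A x) -> compact_set t B.
Proof.
  intros HA HB Hi F HF Hc.
  destruct (HA (fun U => F U \/ U = fun x => ~ B x)) as [l [H1 H2]].
  - intros U [HU| ->]; auto.
  - intros x Hx. destruct (classic (B x)) as [Hb|Hb].
    + destruct (Hc x Hb) as [U [? ?]]. exists U; auto.
    + exists (fun x => ~ B x). auto.
  - exists (filter (fun U => if excluded_middle_informative (F U) then true else false) l).
    split.
    + intros U HU. apply filter_In in HU. destruct HU as [_ HU].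
      destruct (excluded_middle_informative (F U)); [auto|discriminate].
    + intros x Hx. destruct (H2 x (Hi x Hx)) as [U [HU HUx]].
      exists U. split; [|auto]. apply filter_In. split; [auto|].
      destruct (excluded_middle_informative (F U)); [auto|].
      destruct (H1 U HU) as [| ->]; [tauto|]. tauto.
Qed.

Lemma compact_or A B : compact_set t A -> compact_set t B -> compact_set t (fun x => A x \/ B x).
Proof.
  intros HA HB F HF Hc.
  destruct (HA F HF) as [l [H1 H2]]; [auto|].
  destruct (HB F HF) as [l' [H3 H4]]; [auto|].
  exists (l ++ l'). split.
  - intros U HU. apply in_app_or in HU. destruct HU; auto.
  - intros x [Hx|Hx]; [destruct (H2 x Hx) as [U [? ?]]|destruct (H4 x Hx) as [U [? ?]]];
      exists U; split; auto; apply in_or_app; auto.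
Qed.

Lemma compact_empty : compact_set t (fun _ => False).
Proof. intros F _ _. exists nil. simpl. tauto. Qed.

Lemma compact_point x : compact_set t (fun y => y = x).
Proof.
  intros F HF Hc. destruct (Hc x eq_refl) as [U [? ?]].
  exists (U :: nil). split.
  - intros V [<-|[]]; auto.
  - intros y ->. exists U; simpl; auto.
Qed.

Lemma compact_bounded_union (A : nat -> T -> Prop) N :
  (forall n, (n < N)%nat -> compact_set t (A n)) ->
  compact_set t (fun x => exists n, (n < N)%nat /\ A n x).
Proof.
  induction N as [|N IH]; intros H.
  - replace (fun x => exists n, (n < 0)%nat /\ A n x) with (fun _ : T => False).
    + apply compact_empty.
    + apply pred_ext. intros x. split; [tauto|]. intros [n [Hn _]]. lia.
  - replace (fun x => exists n, (n < S N)%nat /\ A n x)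
      with (fun x => (exists n, (n < N)%nat /\ A n x) \/ A N x).
    + apply compact_or; auto.
    + apply pred_ext. intros x. split.
      * intros [[n [Hn ?]]|?]; [exists n; split; auto|exists N; split; auto].
      * intros [n [Hn ?]]. destruct (Nat.eq_dec n N) as [->|]; [auto|].
        left. exists n. split; [lia|auto].
Qed.

Lemma compact_closed A : hausdorff t -> compact_set t A -> closed t A.
Proof.
  intros Hh HA. apply open_locally. intros x Hx.
  destruct (HA (fun U => t U /\ exists V, t V /\ V x /\ forall z, ~ (U z /\ V z)))
    as [l [H1 H2]].
  - tauto.
  - intros y Hy. destruct (Hh y x) as [U [V [? [? [? [? ?]]]]]].
    { intros ->; auto. }
    exists U. split; [|auto]. split; [auto|]. exists V; auto.
  - destruct (@list_choice _ _ (fun U V : T -> Prop => t V /\ V x /\ forall z, ~ (U z /\ V z)) l)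
      as [l' [H3 H4]].
    { intros U HU. apply H1 in HU. tauto. }
    exists (fun y => forall V, In V l' -> V y). split; [|split].
    + apply open_list_inter. intros V HV. destruct (H3 V HV) as [U [_ [? _]]]; auto.
    + intros V HV. destruct (H3 V HV) as [U [_ [_ [? _]]]]; auto.
    + intros y Hy HAy. destruct (H2 y HAy) as [U [HU HUy]].
      destruct (H4 U HU) as [V [HV [_ [_ Hd]]]]. exact (Hd y (conj HUy (Hy V HV))).
Qed.

Lemma compact_hausdorff_regular : compact_space t -> hausdorff t ->
  forall x U, t U -> U x ->
  exists V, t V /\ V x /\ forall y, closure t V y -> U y.
Proof.
  intros Hc Hh x U HU HUx.
  assert (HA : compact_set t (fun y => ~ U y)).
  { apply compact_closed_subset with (fun _ => True); auto.
    - now apply compact_space_set.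
    - now apply open_closed_compl. }
  destruct (HA (fun W => t W /\ exists V, t V /\ V x /\ forall z, ~ (W z /\ V z)))
    as [l [H1 H2]].
  - tauto.
  - intros y Hy. destruct (Hh y x) as [W [V [? [? [? [? ?]]]]]].
    { intros ->; auto. }
    exists W. split; [|auto]. split; [auto|]. exists V; auto.
  - destruct (@list_choice _ _ (fun W V : T -> Prop => t V /\ V x /\ forall z, ~ (W z /\ V z)) l)
      as [l' [H3 H4]].
    { intros W HW. apply H1 in HW. tauto. }
    exists (fun y => forall V, In V l' -> V y). split; [|split].
    + apply open_list_inter. intros V HV. destruct (H3 V HV) as [W [_ [? _]]]; auto.
    + intros V HV. destruct (H3 V HV) as [W [_ [_ [? _]]]]; auto.
    + intros y Hy. apply NNPP. intros Hn. destruct (H2 y Hn) as [W [HW HWy]].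
      destruct (Hy W (proj1 (H1 W HW)) HWy) as [z [Hz1 Hz2]].
      destruct (H4 W HW) as [V [HV [_ [_ Hd]]]]. exact (Hd z (conj Hz1 (Hz2 V HV))).
Qed.

End Topology.

Lemma compact_image (X Y : Type) (tX : opens X) (tY : opens Y) (f : X -> Y) A :
  continuous tX tY f -> compact_set tX A -> compact_set tY (fun y => exists x, A x /\ f x = y).
Proof.
  intros Hf HA F HF Hc.
  destruct (HA (fun V => exists U, F U /\ V = fun x => U (f x))) as [l [H1 H2]].
  - intros V [U [HU ->]]. apply Hf. auto.
  - intros x Hx. destruct (Hc (f x)) as [U [? ?]]; [eauto|].
    exists (fun x => U (f x)). split; [exists U; auto|auto].
  - destruct (@list_choice _ _ (fun V U => F U /\ V = fun x => U (f x)) l H1) as [l' [H3 H4]].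
    exists l'. split.
    + intros U HU. destruct (H3 U HU) as [V [_ [? _]]]. auto.
    + intros y [x [Hx <-]]. destruct (H2 x Hx) as [V [HV HVx]].
      destruct (H4 V HV) as [U [HU [_ ->]]]. exists U; auto.
Qed.

Lemma continuous_comp (X Y Z : Type) (tX : opens X) (tY : opens Y) (tZ : opens Z)
  (f : X -> Y) (g : Y -> Z) :
  continuous tX tY f -> continuous tY tZ g -> continuous tX tZ (fun x => g (f x)).
Proof. intros Hf Hg V HV. exact (Hf _ (Hg V HV)). Qed.

Lemma continuous_id (X : Type) (tX : opens X) : continuous tX tX (fun x => x).
Proof. intros V HV. exact HV. Qed.

(** * Limits of homeomorphisms on the remainder *)

Section StoneCech.
Variables (X : Type) (tX : opens X) (K : Type) (tK : opens K) (e : X -> K).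
Hypothesis Hsc : is_StoneCech tX tK e.

Let HtK : is_topology tK := proj1 Hsc.
Let HcK : compact_space tK := proj1 (proj2 Hsc).
Let HhK : hausdorff tK := proj1 (proj2 (proj2 Hsc)).
Let He : continuous tX tK e := proj1 (proj1 (proj2 (proj2 (proj2 Hsc)))).
Let Hdense : dense tK (fun p => exists x, e x = p) := proj1 (proj2 (proj2 (proj2 (proj2 Hsc)))).

Lemma compact_image_closed C : compact_set tX C -> closed tK (fun p => exists x, C x /\ e x = p).
Proof. intros HC. exact (compact_closed HtK HhK (compact_image He HC)). Qed.

(** The image of [C] is closed in [K] and misses [p], so removing it from [W] leaves a nonempty open
    set, which meets the dense copy of [X]. *)
Lemma remainder_nbhd_escapes p W C : remainder e p -> tK W -> W p -> compact_set tX C ->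
  exists x, W (e x) /\ ~ C x.
Proof.
  intros Hp HW HWp HC.
  destruct (@Hdense (fun q => W q /\ ~ exists x, C x /\ e x = q)) as [q [[Hq1 Hq2] [x <-]]].
  - apply (open_diff HtK); [exact HW|]. now apply compact_image_closed.
  - exists p. split; [auto|]. intros [x [_ Hx]]. apply Hp. now exists x.
  - exists x. split; [auto|]. intros Hx. apply Hq2. now exists x.
Qed.

(** Local compactness makes the copy of [X] open in [K]: near a remainder point [X] would leave the
    compact [C], so an open [V] whose trace lies in [C] contains no remainder point. *)
Lemma remainder_closed : locally_compact tX -> closed tK (remainder e).
Proof.
  intros Hlc. apply (open_locally HtK). intros p Hp.
  apply NNPP in Hp. destruct Hp as [x <-].
  destruct (Hlc x) as [U [C [HU [HUx [HUC HC]]]]]. apply compact_subspace in HC.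
  assert (Hemb := proj2 (proj2 (proj1 (proj2 (proj2 (proj2 Hsc)))))). simpl in Hemb.
  destruct (Hemb U HU) as [V [HV HUV]].
  exists V. split; [auto|]. split; [now apply HUV|].
  intros q Hq Hr. destruct (remainder_nbhd_escapes Hr HV Hq HC) as [y [Hy1 Hy2]].
  apply Hy2, HUC, HUV, Hy1.
Qed.

Lemma continuous_extension (f : X -> X) : continuous tX tX f ->
  exists g : K -> K, continuous tK tK g /\ forall x, g (e x) = e (f x).
Proof.
  intros Hf. apply (proj2 (proj2 (proj2 (proj2 (proj2 Hsc)))) K tK HtK HcK HhK (fun x => e (f x))).
  now apply continuous_comp with tX.
Qed.

Lemma dense_eq (f g : K -> K) : continuous tK tK f -> continuous tK tK g ->
  (forall x, f (e x) = g (e x)) -> forall p, f p = g p.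
Proof.
  intros Hf Hg H p. apply NNPP. intros Hn.
  destruct (HhK Hn) as [U [V [HU [HV [HUp [HVp Hd]]]]]].
  destruct (@Hdense (fun q => U (f q) /\ V (g q))) as [q [[H1 H2] [x <-]]].
  - apply open_inter; [exact HtK|exact (Hf U HU)|exact (Hg V HV)].
  - exists p; auto.
  - rewrite H in H1. exact (Hd _ (conj H1 H2)).
Qed.

Variables (I : Type) (le : I -> I -> Prop).
Hypothesis le_refl : forall a, le a a.
Hypothesis le_trans : forall a b c, le a b -> le b c -> le a c.
Hypothesis le_total : forall a b, le a b \/ le b a.
Hypothesis I_inh : inhabited I.

Lemma le_upper a b : exists c, le a c /\ le b c.
Proof. destruct (le_total a b); [exists b|exists a]; auto. Qed.

(* A disjoint pair of closed sets stands for a [0,1]-valued function equal to 0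
   on the first and 1 on the second set. *)
Definition coherent (Phi : I -> X -> X) : Prop :=
  forall A A', closed tX A -> closed tX A' -> (forall x, ~ (A x /\ A' x)) ->
  exists a, forall b c, le a b -> le a c ->
  exists C, compact_set tX C /\ forall x, ~ C x -> ~ (A (Phi b x) /\ A' (Phi c x)).

Definition tends (bF : I -> K -> K) (p q : K) : Prop :=
  forall U, tK U -> U q -> exists a, forall b, le a b -> U (bF b p).

Section OneFamily.
Variables (Phi : I -> X -> X) (bF : I -> K -> K).
Hypothesis bF_cont : forall a, continuous tK tK (bF a).
Hypothesis bF_ext : forall a x, bF a (e x) = e (Phi a x).
Hypothesis Phi_coh : coherent Phi.

(** [coherent] is applied to the traces of [closure U] and of the complement of [V]. The set of
    points violating the conclusion is open in [K], so a remainder point in it would give a point of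
    [X] in it outside the exceptional compact set. One stage [a] serves all [p]: this is the
    uniformity behind the continuity of limits. *)
Lemma coherent_remainder U V : tK U -> tK V -> (forall q, closure tK U q -> V q) ->
  exists a, forall b c p, le a b -> le a c -> remainder e p ->
    U (bF b p) -> closure tK V (bF c p).
Proof.
  intros HU HV Hi.
  destruct (@Phi_coh (fun x => closure tK U (e x)) (fun x => ~ V (e x))) as [a Ha].
  - exact (He (closure_closed HtK U)).
  - exact (He (open_closed_compl HV)).
  - intros x [H1 H2]. exact (H2 (Hi _ H1)).
  - exists a. intros b c p Hb Hc Hp HUp. apply NNPP. intros Hn.
    destruct (Ha b c Hb Hc) as [C [HC HCd]].
    destruct (@remainder_nbhd_escapes p (fun q => U (bF b q) /\ ~ closure tK V (bF c q)) C)
      as [x [[H1 H2] H3]]; auto.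
    + apply open_inter; [exact HtK|exact (bF_cont b HU)|].
      exact (bF_cont c (closure_closed HtK V)).
    + apply (HCd x H3). rewrite bF_ext in H1, H2. split.
      * now apply closure_incl.
      * intros HVx. apply H2. now apply closure_incl.
Qed.

Lemma cluster_exists p : exists q, forall U, tK U -> U q -> forall a, exists b, le a b /\ U (bF b p).
Proof.
  apply NNPP. intros Hn.
  destruct (@HcK (fun U => tK U /\ exists a, forall b, le a b -> ~ U (bF b p))) as [l [H1 H2]].
  - tauto.
  - intros q. apply NNPP. intros Hq. apply Hn. exists q. intros U HU HUq a.
    apply NNPP. intros Hb. apply Hq. exists U. split; [|auto]. split; [auto|].
    exists a. intros b Hab HUb. apply Hb. now exists b.
  - assert (H3 : exists a, forall U, In U l -> forall b, le a b -> ~ U (bF b p)).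
    { clear H2. induction l as [|U l IH].
      - destruct I_inh as [a]. exists a. simpl; tauto.
      - destruct IH as [a Ha]; [intros; apply H1; simpl; auto|].
        destruct (H1 U (or_introl eq_refl)) as [_ [a' Ha']].
        destruct (le_upper a a') as [c [Hc Hc']].
        exists c. intros V [<-|HV] b Hb.
        + apply Ha'. eauto.
        + apply Ha; eauto. }
    destruct H3 as [a Ha]. destruct (H2 (bF a p)) as [U [HU HUa]].
    exact (Ha U HU a (le_refl a) HUa).
Qed.

(** Compactness gives a cluster point, and coherence turns it into a limit: once one late stage puts
    [p] into [W], all late stages keep it in [closure V], inside [U]. Two nested neighbourhoods are
    taken because [coherent_remainder] loses one closure. *)
Lemma tends_exists p : remainder e p -> exists q, tends bF p q.
Proof.
  intros Hp. destruct (cluster_exists p) as [q Hq]. exists q. intros U HU HUq.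
  destruct (compact_hausdorff_regular HtK HcK HhK HU HUq) as [V [HV [HVq HVU]]].
  destruct (compact_hausdorff_regular HtK HcK HhK HV HVq) as [W [HW [HWq HWV]]].
  destruct (coherent_remainder HW HV HWV) as [a Ha].
  destruct (Hq W HW HWq a) as [b [Hb HWb]].
  exists a. intros c Hc. apply HVU. now apply (Ha b c p).
Qed.

Lemma tends_uniform U V : tK U -> tK V -> (forall q, closure tK U q -> V q) ->
  exists a, forall b p q, le a b -> remainder e p -> tends bF p q ->
    U (bF b p) -> closure tK V q.
Proof.
  intros HU HV Hi. destruct (coherent_remainder HU HV Hi) as [a Ha].
  exists a. intros b p q Hb Hp Hpq HUp. apply NNPP. intros Hn.
  destruct (Hpq _ (closure_closed HtK V) Hn) as [a' Ha'].
  destruct (le_upper a a') as [c [Hc Hc']].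
  exact (Ha' c Hc' (Ha b c p Hb Hc Hp HUp)).
Qed.

(** A uniform limit of continuous maps: near [p] the limit is controlled by [bF c] for a single late
    [c]. *)
Lemma tends_continuous (psi : Xstar e -> Xstar e) :
  (forall p, tends bF (proj1_sig p) (proj1_sig (psi p))) ->
  continuous (Xstar_top tK e) (Xstar_top tK e) psi.
Proof.
  intros Hpsi V [U [HU HVU]].
  (* The open set of [K] demanded by the subspace topology is the union of all open [W] whose
     remainder points [psi] carries into [U]. *)
  exists (fun p => exists W, (tK W /\ forall r : Xstar e, W (proj1_sig r) -> U (proj1_sig (psi r)))
    /\ W p).
  split.
  - apply open_union; [exact HtK|tauto].
  - intros p. rewrite HVU. split.
    + intros HUp.
      destruct (compact_hausdorff_regular HtK HcK HhK HU HUp) as [V1 [HV1 [HVq HVU1]]].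
      destruct (compact_hausdorff_regular HtK HcK HhK HV1 HVq) as [W [HW [HWq HWV]]].
      destruct (tends_uniform HW HV1 HWV) as [a Ha].
      destruct (Hpsi p W HW HWq) as [a' Ha'].
      destruct (le_upper a a') as [c [Hc Hc']].
      exists (fun r => W (bF c r)). split; [|auto]. split; [exact (bF_cont c HW)|].
      intros r Hr. apply HVU1. apply (Ha c (proj1_sig r)); auto. apply (proj2_sig r).
    + intros [W [[_ HW] HWp]]. auto.
Qed.

End OneFamily.

(** Pointwise limits alone do not compose. A stage [b] with [bG b q] near [p'] is fixed; by
    continuity of [bG b] a later [c] puts [bG b (bF c p)] there too; coherence then replaces [bG b]
    by [bG c], and [bG c (bF c p) = p]. *)
Lemma tends_inverse (Phi' : I -> X -> X) (bF bG : I -> K -> K) p q p' :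
  (forall a, continuous tK tK (bF a)) -> (forall a, continuous tK tK (bG a)) ->
  (forall a x, bG a (e x) = e (Phi' a x)) ->
  coherent Phi' ->
  (forall a p, bG a (bF a p) = p) ->
  (forall a p, remainder e p -> remainder e (bF a p)) ->
  remainder e p -> tends bF p q -> tends bG q p' -> p = p'.
Proof.
  intros HF HG HG' Hcoh Hinv Hrem Hp Hpq Hqp. apply NNPP. intros Hn.
  destruct (HhK Hn) as [O [U [HO [HU [HOp [HUp Hd]]]]]].
  destruct (compact_hausdorff_regular HtK HcK HhK HU HUp) as [V [HV [HVq HVU]]].
  destruct (compact_hausdorff_regular HtK HcK HhK HV HVq) as [W [HW [HWq HWV]]].
  destruct (coherent_remainder HG HG' Hcoh HW HV HWV) as [a Ha].
  destruct (Hqp W HW HWq) as [a' Ha'].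
  destruct (le_upper a a') as [b [Hb Hb']].
  destruct (Hpq (fun z => W (bG b z)) (HG b W HW) (Ha' b Hb')) as [a'' Ha''].
  destruct (le_upper a a'') as [c [Hc Hc']].
  apply (Hd p). split; [auto|]. apply HVU.
  rewrite <- (Hinv c p). apply (Ha b c); auto.
Qed.

Lemma limit_homeomorphism (Phi Phi' : I -> X -> X) :
  locally_compact tX ->
  (forall a, continuous tX tX (Phi a)) -> (forall a, continuous tX tX (Phi' a)) ->
  (forall a x, Phi' a (Phi a x) = x) -> (forall a x, Phi a (Phi' a x) = x) ->
  coherent Phi -> coherent Phi' ->
  exists (bF : I -> K -> K) (psi : Xstar e -> Xstar e),
    (forall a x, bF a (e x) = e (Phi a x)) /\ (forall a, continuous tK tK (bF a)) /\
    homeomorphism (Xstar_top tK e) (Xstar_top tK e) psi /\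
    (forall p, tends bF (proj1_sig p) (proj1_sig (psi p))).
Proof.
  intros Hlc HP HP' Hi1 Hi2 Hco Hco'.
  destruct (choice (fun a g => continuous tK tK g /\ forall x, g (e x) = e (Phi a x))
    (fun a => continuous_extension (HP a))) as [bF HF].
  destruct (choice (fun a g => continuous tK tK g /\ forall x, g (e x) = e (Phi' a x))
    (fun a => continuous_extension (HP' a))) as [bG HG].
  assert (HF1 := fun a => proj1 (HF a)). assert (HF2 := fun a => proj2 (HF a)).
  assert (HG1 := fun a => proj1 (HG a)). assert (HG2 := fun a => proj2 (HG a)).
  assert (HGF : forall a p, bG a (bF a p) = p).
  { intros a. apply (dense_eq (f := fun p => bG a (bF a p)) (g := fun p => p)).
    - now apply continuous_comp with tK.
    - apply continuous_id.
    - intros x. now rewrite HF2, HG2, Hi1. }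
  assert (HFG : forall a p, bF a (bG a p) = p).
  { intros a. apply (dense_eq (f := fun p => bF a (bG a p)) (g := fun p => p)).
    - now apply continuous_comp with tK.
    - apply continuous_id.
    - intros x. now rewrite HG2, HF2, Hi2. }
  assert (HFr : forall a p, remainder e p -> remainder e (bF a p)).
  { intros a p Hp [x Hx]. apply Hp. exists (Phi' a x). now rewrite <- HG2, Hx. }
  assert (HGr : forall a p, remainder e p -> remainder e (bG a p)).
  { intros a p Hp [x Hx]. apply Hp. exists (Phi a x). now rewrite <- HF2, Hx. }
  assert (Hlim : forall (b : I -> K -> K) p q, (forall a p, remainder e p -> remainder e (b a p)) ->
    remainder e p -> tends b p q -> remainder e q).
  { intros b p q Hb Hp Hpq. apply NNPP. intros Hq.
    destruct (Hpq _ (remainder_closed Hlc) Hq) as [a Ha].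
    exact (Ha a (le_refl a) (Hb a p Hp)). }
  destruct (choice (fun p q : Xstar e => tends bF (proj1_sig p) (proj1_sig q))) as [psi Hpsi].
  { intros [p Hp]. destruct (tends_exists HF1 HF2 Hco Hp) as [q Hq].
    exists (exist _ q (Hlim bF p q HFr Hp Hq)). exact Hq. }
  destruct (choice (fun p q : Xstar e => tends bG (proj1_sig p) (proj1_sig q))) as [psi' Hpsi'].
  { intros [p Hp]. destruct (tends_exists HG1 HG2 Hco' Hp) as [q Hq].
    exists (exist _ q (Hlim bG p q HGr Hp Hq)). exact Hq. }
  assert (Heq : forall p q : Xstar e, proj1_sig p = proj1_sig q -> p = q).
  { intros [p Hp] [q Hq]. simpl. intros <-. f_equal. apply proof_irrelevance. }
  exists bF, psi. split; [exact HF2|]. split; [exact HF1|]. split; [|exact Hpsi].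
  split; [exact (tends_continuous HF1 HF2 Hco Hpsi)|].
  exists psi'. split; [exact (tends_continuous HG1 HG2 Hco' Hpsi')|]. split.
  - intros p. apply Heq. symmetry.
    apply (tends_inverse (Phi' := Phi') (bF := bF) (bG := bG) (q := proj1_sig (psi p))); auto.
    apply (proj2_sig p).
  - intros p. apply Heq. symmetry.
    apply (tends_inverse (Phi' := Phi) (bF := bG) (bG := bF) (q := proj1_sig (psi' p))); auto.
    apply (proj2_sig p).
Qed.

End StoneCech.

(** * Norms on sets of homeomorphisms and towers *)

Definition eventually (P : nat -> Prop) : Prop := exists N, forall n, (N <= n)%nat -> P n.

Lemma eventually_mono (P Q : nat -> Prop) :
  (forall n, P n -> Q n) -> eventually P -> eventually Q.
Proof. intros H [N HN]. exists N. auto. Qed.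

Lemma eventually_and P Q : eventually P -> eventually Q -> eventually (fun n => P n /\ Q n).
Proof.
  intros [N HN] [M HM]. exists (max N M). intros n Hn. split; [apply HN|apply HM]; lia.
Qed.

Lemma eventually_bounded (P : nat -> nat -> Prop) m :
  (forall i, (i <= m)%nat -> eventually (P i)) ->
  eventually (fun n => forall i, (i <= m)%nat -> P i n).
Proof.
  induction m as [|m IH]; intros H.
  - apply eventually_mono with (P 0%nat); [|auto].
    intros n Hn i Hi. now replace i with 0%nat by lia.
  - apply eventually_mono with (fun n => (forall i, (i <= m)%nat -> P i n) /\ P (S m) n).
    + intros n [H1 H2] i Hi. destruct (Nat.eq_dec i (S m)) as [->|]; [auto|]. apply H1. lia.
    + apply eventually_and; auto.
Qed.

(** [m n] is the largest [k <= n] with [Q n k], if there is one. It tends to infinity because every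
    fixed [k] eventually qualifies. *)
Lemma eventually_diagonal (Q : nat -> nat -> Prop) :
  (forall k, eventually (fun n => Q n k)) ->
  exists m : nat -> nat, (forall k, eventually (fun n => (k <= m n)%nat)) /\
                         eventually (fun n => Q n (m n)).
Proof.
  intros H.
  assert (Hm : forall n, exists m, (forall k, (k <= n)%nat -> Q n k -> (k <= m)%nat) /\
                                   ((exists k, (k <= n)%nat /\ Q n k) -> Q n m)).
  (* Only the bound on [k] is generalised, so that the induction searches upwards at a fixed index
     [n]. *)
  { intros n. generalize n at 1 3 as b. induction b as [|b [m [H1 H2]]].
    - exists 0%nat. split; [intros; lia|]. intros [k [Hk Hq]]. now replace 0%nat with k by lia.
    - destruct (classic (Q n (S b))) as [Hq|Hq].
      + exists (S b). split; auto.
      + exists m. split.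
        * intros k Hk Hqk. apply H1; auto. destruct (Nat.eq_dec k (S b)) as [->|]; [tauto|lia].
        * intros [k [Hk Hqk]]. apply H2. exists k. split; auto.
          destruct (Nat.eq_dec k (S b)) as [->|]; [tauto|lia]. }
  destruct (choice _ Hm) as [m Hm']. exists m. split.
  - intros k. destruct (H k) as [N HN]. exists (max N k). intros n Hn.
    apply (Hm' n); [lia|]. apply HN. lia.
  - destruct (H 0%nat) as [N HN]. exists N. intros n Hn. apply (Hm' n).
    exists 0%nat. split; [lia|auto].
Qed.

Section Norm.
Variables (X : Type) (tX : opens X).
Hypothesis HtX : is_topology tX.

(* A homeomorphism of X, paired with its inverse. *)
Definition aut : Type := ((X -> X) * (X -> X))%type.

Definition supported (B : X -> Prop) (r : aut) : Prop :=
  continuous tX tX (fst r) /\ continuous tX tX (snd r) /\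
  (forall x, snd r (fst r x) = x) /\ (forall x, fst r (snd r x) = x) /\
  (forall x, ~ B x -> fst r x = x).

(** [r] and [r'] may differ, so that any two late stages of the tower can be compared with each
    other; the second half serves the convergence of the inverses. *)
Definition decides (B : X -> Prop) (S : aut -> Prop) (A A' : X -> Prop) : Prop :=
  forall r r' x, S r -> S r' -> B x ->
    ~ (A (fst r x) /\ A' (fst r' x)) /\ ~ (A (snd r x) /\ A' (snd r' x)).

(** Requiring [C] and [C'] to lie in [B] lets such sets, taken over all blocks of a discrete family,
    be united to two closed sets that are still disjoint. *)
Definition splits (B : X -> Prop) (S S' : aut -> Prop) : Prop :=
  exists p C C', B p /\ closed tX C /\ closed tX C' /\
    (forall x, C x -> B x) /\ (forall x, C' x -> B x) /\ (forall x, ~ (C x /\ C' x)) /\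
    (forall r, S r -> C (fst r p)) /\ (forall r, S' r -> C' (fst r p)).

(* Norm at least k: the set survives k rounds of deciding a disjoint pair of
   closed sets or of splitting into two separated pieces. *)
Fixpoint large (B : X -> Prop) (k : nat) (S : aut -> Prop) : Prop :=
  (exists r, S r) /\ (forall r, S r -> supported B r) /\
  match k with
  | 0%nat => True
  | Datatypes.S k =>
      (forall A A', closed tX A -> closed tX A' -> (forall x, ~ (A x /\ A' x)) ->
        exists S', (forall r, S' r -> S r) /\ large B k S' /\ decides B S' A A') /\
      (exists S0 S1, (forall r, S0 r -> S r) /\ (forall r, S1 r -> S r) /\
        large B k S0 /\ large B k S1 /\ splits B S0 S1)
  end.

Lemma splits_sym B S S' : splits B S S' -> splits B S' S.
Proof.
  intros [p [C [C' [H1 [H2 [H3 [H4 [H5 [H6 [H7 H8]]]]]]]]]].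
  exists p, C', C. repeat (split; auto). intros x [? ?]. apply (H6 x); auto.
Qed.

Lemma large_inhabited B k S : large B k S -> exists r, S r.
Proof. destruct k; intros H; apply H. Qed.

Lemma large_supported B k S r : large B k S -> S r -> supported B r.
Proof. destruct k; intros H; apply H. Qed.

Lemma large_pred B k S : large B (Datatypes.S k) S -> large B k S.
Proof.
  revert S. induction k as [|k IH]; intros S [H1 [H2 [H3 H4]]].
  - simpl. auto.
  - split; [auto|]. split; [auto|]. split.
    + intros A A' HA HA' Hd. destruct (H3 A A' HA HA' Hd) as [S' [? [? ?]]].
      exists S'. auto.
    + destruct H4 as [S0 [S1 [? [? [? [? ?]]]]]]. exists S0, S1. repeat (split; auto).
Qed.

Lemma large_le B k l S : (k <= l)%nat -> large B l S -> large B k S.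
Proof. intros Hkl. induction Hkl; auto. intros H. apply IHHkl. now apply large_pred. Qed.

Variable B : nat -> X -> Prop.

Definition autseq : Type := nat -> aut -> Prop.
Definition good (s : autseq) : Prop := forall k, eventually (fun n => large (B n) k (s n)).
Definition almost_sub (s u : autseq) : Prop := eventually (fun n => forall r, s n r -> u n r).

Lemma almost_sub_refl s : almost_sub s s.
Proof. exists 0%nat. auto. Qed.

Lemma almost_sub_trans s u v : almost_sub s u -> almost_sub u v -> almost_sub s v.
Proof.
  intros H1 H2. apply (eventually_mono (fun n H r Hr => proj2 H r (proj1 H r Hr))
    (eventually_and H1 H2)).
Qed.

(** A pseudo-intersection: [j m] is an index almost below the first [m + 1] terms, and coordinate
    [n] is copied from term [j (m n)], with [m n] growing so slowly that the norm is at least [m n]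
    and the almost inclusions already hold at [n]. *)
Lemma tower_lower_bound (u : nat -> autseq) :
  (forall i, good (u i)) -> (forall i j, almost_sub (u i) (u j) \/ almost_sub (u j) (u i)) ->
  exists s, good s /\ forall i, almost_sub s (u i).
Proof.
  intros Hg Hc.
  assert (Hj : forall m, exists j, forall i, (i <= m)%nat -> almost_sub (u j) (u i)).
  { induction m as [|m [j Hj]].
    - exists 0%nat. intros i Hi. replace i with 0%nat by lia. apply almost_sub_refl.
    - destruct (Hc j (S m)) as [H|H].
      + exists j. intros i Hi. destruct (Nat.eq_dec i (S m)) as [->|]; [auto|]. apply Hj. lia.
      + exists (S m). intros i Hi. destruct (Nat.eq_dec i (S m)) as [->|].
        * apply almost_sub_refl.
        * apply almost_sub_trans with (u j); [auto|]. apply Hj. lia. }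
  destruct (choice _ Hj) as [j Hj'].
  destruct (@eventually_diagonal (fun n m => large (B n) m (u (j m) n) /\
    forall i, (i <= m)%nat -> forall r, u (j m) n r -> u i n r)) as [m [Hm1 Hm2]].
  { intros m. apply eventually_and; [apply Hg|].
    apply (@eventually_bounded (fun i n => forall r, u (j m) n r -> u i n r)).
    intros i Hi. now apply Hj'. }
  exists (fun n => u (j (m n)) n). split.
  - intros k. generalize (eventually_and (Hm1 k) Hm2). apply eventually_mono.
    intros n [H1 [H2 _]]. now apply large_le with (m n).
  - intros i. generalize (eventually_and (Hm1 i) Hm2). apply eventually_mono.
    intros n [H1 [_ H2]]. now apply H2.
Qed.

Definition closed_disjoint (A : (X -> Prop) * (X -> Prop)) : Prop :=
  closed tX (fst A) /\ closed tX (snd A) /\ forall x, ~ (fst A x /\ snd A x).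

(** Each coordinate spends two rounds of its norm: a decision, then a split inside the decided set,
    so that both halves inherit the decision. Starting from norm [m n + 2] with [m n] tending to
    infinity keeps both halves [good]. *)
Lemma tower_step (A : (X -> Prop) * (X -> Prop)) s : closed_disjoint A -> good s ->
  exists u : bool -> autseq,
    (forall b, good (u b) /\ almost_sub (u b) s /\
       eventually (fun n => decides (B n) (u b n) (fst A) (snd A))) /\
    eventually (fun n => splits (B n) (u true n) (u false n)).
Proof.
  intros [HA [HA' Hd]] Hs.
  destruct (@eventually_diagonal (fun n k => large (B n) (Datatypes.S (Datatypes.S k)) (s n)))
    as [m [Hm1 Hm2]].
  { intros k. apply Hs. }
  assert (H : forall n, exists u : bool -> aut -> Prop,
    large (B n) (Datatypes.S (Datatypes.S (m n))) (s n) ->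
    (forall b, large (B n) (m n) (u b) /\ (forall r, u b r -> s n r) /\
       decides (B n) (u b) (fst A) (snd A)) /\ splits (B n) (u true) (u false)).
  { intros n. destruct (classic (large (B n) (Datatypes.S (Datatypes.S (m n))) (s n))) as [Hl|Hl].
    - destruct Hl as [_ [_ [Hl _]]].
      destruct (Hl (fst A) (snd A) HA HA' Hd) as [S' [HS1 [[_ [_ [_ HS2]]] HS3]]].
      destruct HS2 as [S0 [S1 [H0 [H1 [H2 [H3 H4]]]]]].
      exists (fun b : bool => if b then S0 else S1). intros _. split; [|auto].
      intros [|].
      + split; [auto|]. split; [auto|]. intros r r' x Hr Hr' Hx. apply HS3; auto.
      + split; [auto|]. split; [auto|]. intros r r' x Hr Hr' Hx. apply HS3; auto.
    - exists (fun _ => s n). tauto. }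
  destruct (choice _ H) as [u Hu]. exists (fun b n => u n b). split.
  - intros b. split; [|split].
    + intros k. generalize (eventually_and (Hm1 k) Hm2). apply eventually_mono.
      intros n [H1 H2]. apply large_le with (m n); [auto|]. now apply (Hu n H2).
    + generalize Hm2. apply eventually_mono. intros n H2. now apply (Hu n H2).
    + generalize Hm2. apply eventually_mono. intros n H2. now apply (Hu n H2).
  - generalize Hm2. apply eventually_mono. intros n H2. now apply (Hu n H2).
Qed.

Variables (I : Type) (lt : I -> I -> Prop).
Hypothesis lt_wf : well_founded lt.
Hypothesis lt_trans : forall a b c, lt a b -> lt b c -> lt a c.
Hypothesis lt_total : forall a b, lt a b \/ a = b \/ lt b a.
Hypothesis lt_countable : forall a, exists u : nat -> I, forall b, lt b a -> exists n, u n = b.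
Variable code : I -> (X -> Prop) * (X -> Prop).

Lemma almost_sub_chain (T : I -> autseq) (a : I) :
  (forall b, lt b a -> good (T b)) ->
  (forall b c, lt b a -> lt c b -> almost_sub (T b) (T c)) ->
  (exists s, good s) ->
  exists s, good s /\ forall b, lt b a -> almost_sub s (T b).
Proof.
  intros Hg Hc [s0 Hs0].
  destruct (classic (exists b, lt b a)) as [[b0 Hb0]|Hn].
  - destruct (lt_countable a) as [u Hu].
    (* The enumeration [u] may list indices that are not below [a]; they are replaced by [b0]. *)
    set (v := fun n => if excluded_middle_informative (lt (u n) a) then u n else b0).
    assert (Hv : forall n, lt (v n) a).
    { intros n. unfold v. destruct (excluded_middle_informative _); auto. }
    destruct (@tower_lower_bound (fun n => T (v n))) as [s [Hs1 Hs2]].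
    + intros i. apply Hg, Hv.
    + intros i j. destruct (lt_total (v i) (v j)) as [H|[H|H]].
      * right. apply Hc; auto.
      * left. rewrite H. apply almost_sub_refl.
      * left. apply Hc; auto.
    + exists s. split; [auto|]. intros b Hb. destruct (Hu b Hb) as [n Hn].
      specialize (Hs2 n). unfold v in Hs2. rewrite Hn in Hs2.
      destruct (excluded_middle_informative _); tauto.
  - exists s0. split; [auto|]. intros b Hb. exfalso. apply Hn. now exists b.
Qed.

(** Lower bounds [lb] and steps [st] are fixed beforehand as total functions, correct on suitable
    input, so that the recursion carries no proofs of goodness; a separate induction supplies them.
    Neither depends on the branch, so two branches agree up to the first place where they differ and
    there receive the two halves of one split. *)
Lemma tower_exists : (exists s, good s) ->
  exists T : (I -> bool) -> I -> autseq,
    (forall x a, good (T x a)) /\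
    (forall x a b, lt b a -> almost_sub (T x a) (T x b)) /\
    (forall x a, closed_disjoint (code a) ->
       eventually (fun n => decides (B n) (T x a n) (fst (code a)) (snd (code a)))) /\
    (forall x y, x <> y -> exists a, eventually (fun n => splits (B n) (T x a n) (T y a n))).
Proof.
  intros Hex.
  destruct (choice (fun (F : autseq -> Prop) s =>
    (exists s, good s /\ forall u, F u -> almost_sub s u) ->
    good s /\ forall u, F u -> almost_sub s u)) as [lb Hlb].
  { intros F. destruct (classic (exists s, good s /\ forall u, F u -> almost_sub s u)) as [[s H]|H].
    - exists s. auto.
    - destruct Hex as [s _]. exists s. tauto. }
  destruct (choice (fun (as_ : I * autseq) (u : bool -> autseq) => good (snd as_) ->
    (forall b, good (u b) /\ almost_sub (u b) (snd as_) /\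
       (closed_disjoint (code (fst as_)) ->
        eventually (fun n => decides (B n) (u b n) (fst (code (fst as_))) (snd (code (fst as_)))))) /\
    eventually (fun n => splits (B n) (u true n) (u false n)))) as [st Hst].
  { intros [a s]. simpl. destruct (classic (good s)) as [Hs|Hs].
    - destruct (classic (closed_disjoint (code a))) as [Hd|Hd].
      + destruct (tower_step Hd Hs) as [u [Hu1 Hu2]]. exists u. intros _. split; [|auto].
        intros b. destruct (Hu1 b) as [? [? ?]]. auto.
      (* A code that is no disjoint closed pair asks for no decision, but the stage must still
         split; the pair of empty sets provides this. *)
      + destruct (@tower_step (fun _ => False, fun _ => False) s) as [u [Hu1 Hu2]]; auto.
        * repeat split; simpl; try tauto;
            apply (open_ext (open_full HtX)); tauto.
        * exists u. intros _. split; [|auto]. intros b. destruct (Hu1 b) as [? [? ?]]. tauto.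
    - exists (fun _ => s). tauto. }
  set (body := fun (x : I -> bool) (a : I) (rec : forall b, lt b a -> autseq) =>
    st (a, lb (fun s => exists b (h : lt b a), s = rec b h)) (x a)).
  set (T := fun x => Fix lt_wf (fun _ => autseq) (body x)).
  assert (HT : forall x a, T x a = st (a, lb (fun s => exists b, lt b a /\ s = T x b)) (x a)).
  { intros x a. unfold T. rewrite Fix_eq.
    - unfold body. do 3 f_equal. apply pred_ext. intros s. split.
      + intros [b [h ->]]. exists b. auto.
      + intros [b [h ->]]. exists b, h. auto.
    - clear. intros a f g H. unfold body. do 3 f_equal. apply pred_ext. intros s.
      split; intros [b [h ->]]; exists b, h; auto. }
  assert (Hlow : forall x a,
    (forall b, lt b a -> good (T x b) /\ forall c, lt c b -> almost_sub (T x b) (T x c)) ->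
    good (lb (fun s => exists b, lt b a /\ s = T x b)) /\
    forall b, lt b a -> almost_sub (lb (fun s => exists b, lt b a /\ s = T x b)) (T x b)).
  { intros x a IH. destruct (Hlb (fun s => exists b, lt b a /\ s = T x b)) as [H1 H2].
    - destruct (@almost_sub_chain (T x) a) as [s [Hs1 Hs2]]; auto.
      + intros b Hb. now apply IH.
      + intros b c Hb Hc. now apply (IH b Hb).
      + exists s. split; [auto|]. intros u [b [Hb ->]]. auto.
    - split; [auto|]. intros b Hb. apply H2. now exists b. }
  assert (Hall : forall x a, good (T x a) /\ forall b, lt b a -> almost_sub (T x a) (T x b)).
  { intros x a. induction (lt_wf a) as [a _ IH].
    destruct (Hlow x a IH) as [H1 H2].
    destruct (Hst (a, lb (fun s => exists b, lt b a /\ s = T x b)) H1) as [H3 _].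
    destruct (H3 (x a)) as [H4 [H5 _]]. rewrite <- HT in H4, H5. split; [auto|].
    intros b Hb. apply almost_sub_trans with (1 := H5). simpl. auto. }
  exists T. split; [|split; [|split]].
  - intros x a. apply Hall.
  - intros x a. apply Hall.
  - intros x a Ha. destruct (Hlow x a) as [H1 _]; [intros; apply Hall|].
    destruct (Hst (a, lb (fun s => exists b, lt b a /\ s = T x b)) H1) as [H3 _].
    destruct (H3 (x a)) as [_ [_ H5]]. rewrite <- HT in H5. now apply H5.
  - intros x y Hxy.
    assert (Hmin : exists a, x a <> y a /\ forall b, lt b a -> x b = y b).
    { apply NNPP. intros Hn. apply Hxy. apply functional_extensionality. intros a.
      induction (lt_wf a) as [a _ IH]. apply NNPP. intros Ha. apply Hn. exists a. auto. }
    destruct Hmin as [a [Ha Hb]]. exists a.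
    assert (Heq : forall b, lt b a -> T x b = T y b).
    { intros b. induction (lt_wf b) as [b _ IH]. intros Hba. rewrite !HT, (Hb b Hba).
      do 3 f_equal. apply pred_ext. intros s. split; intros [c [Hc ->]]; exists c; split; auto.
      - apply IH; eauto.
      - symmetry. apply IH; eauto. }
    assert (Hset : (fun s => exists b, lt b a /\ s = T y b) = (fun s => exists b, lt b a /\ s = T x b)).
    { apply pred_ext. intros s. split; intros [c [Hc ->]]; exists c; split; auto.
      symmetry. auto. }
    destruct (Hlow x a) as [H1 _]; [intros; apply Hall|].
    destruct (Hst (a, lb (fun s => exists b, lt b a /\ s = T x b)) H1) as [_ H3].
    rewrite (HT x a), (HT y a), Hset.
    destruct (x a), (y a); try tauto.
    revert H3. apply eventually_mono. intros n. apply splits_sym.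
Qed.

End Norm.

(** * Disjoint closed sets of a metric space have disjoint closures in its compactification *)

Definition real_top : opens R :=
  fun U => forall x, U x -> exists eps, 0 < eps /\ forall y, Rabs (x - y) < eps -> U y.

Lemma real_top_topology : is_topology real_top.
Proof.
  split; [|split].
  - intros x _. exists 1. split; [lra|auto].
  - intros U V HU HV x [H1 H2]. destruct (HU x H1) as [a [Ha Ha']].
    destruct (HV x H2) as [b [Hb Hb']]. exists (Rmin a b). split; [now apply Rmin_pos|].
    intros y Hy. assert (H3 := Rmin_l a b). assert (H4 := Rmin_r a b).
    split; [apply Ha'|apply Hb']; lra.
  - intros F HF x [U [HU HUx]]. destruct (HF U HU x HUx) as [a [Ha Ha']].
    exists a. split; [auto|]. intros y Hy. exists U. auto.
Qed.

Lemma open_gt a : real_top (fun y => a < y).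
Proof.
  intros x Hx. exists (x - a). split; [lra|]. intros y Hy. apply Rabs_def2 in Hy. lra.
Qed.

Lemma open_lt a : real_top (fun y => y < a).
Proof.
  intros x Hx. exists (a - x). split; [lra|]. intros y Hy. apply Rabs_def2 in Hy. lra.
Qed.

Lemma unit_interval_compact : compact_set real_top (fun x => 0 <= x <= 1).
Proof.
  intros F HF Hc.
  set (E := fun c => 0 <= c <= 1 /\ exists l, (forall U, In U l -> F U) /\
    forall x, 0 <= x <= c -> exists U, In U l /\ U x).
  assert (E0 : E 0).
  { split; [lra|]. destruct (Hc 0) as [U [HU HU0]]; [lra|]. exists (U :: nil). split.
    - intros V [<-|[]]; auto.
    - intros x Hx. exists U. split; [simpl; auto|]. now replace x with 0 by lra. }
  destruct (completeness E) as [c [Hub Hlub]].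
  { exists 1. intros x [Hx _]. lra. }
  { now exists 0. }
  assert (Hc01 : 0 <= c <= 1).
  { split; [now apply Hub|]. apply Hlub. intros x [Hx _]. lra. }
  destruct (Hc c Hc01) as [U [HU HUc]]. destruct (HF U HU c HUc) as [eps [Heps HUe]].
  assert (Hd : exists d, E d /\ c - eps < d).
  { apply NNPP. intros Hn. assert (c <= c - eps); [|lra]. apply Hlub. intros d Hd.
    apply Rnot_lt_le. intros Hl. apply Hn. now exists d. }
  destruct Hd as [d [[Hd1 [l [Hl1 Hl2]]] Hd2]].
  assert (Hext : forall c', c' < c + eps -> 0 <= c' <= 1 -> E c').
  { intros c' Hc' Hc1. split; [auto|]. exists (U :: l). split.
    - intros V [<-|HV]; auto.
    - intros x Hx. destruct (Rle_dec x d) as [Hxd|Hxd].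
      + destruct (Hl2 x) as [V [? ?]]; [lra|]. exists V. simpl; auto.
      + exists U. split; [simpl; auto|]. apply HUe. apply Rabs_def1; lra. }
  assert (Hc1 : c = 1).
  { apply NNPP. intros Hn.
    assert (Hm : E (Rmin 1 (c + eps / 2))).
    { apply Hext; [assert (H := Rmin_r 1 (c + eps / 2)); lra|].
      split; [apply Rmin_glb; lra|apply Rmin_l]. }
    apply Hub in Hm. revert Hm. unfold Rmin. destruct (Rle_dec _ _); lra. }
  destruct (Hext 1) as [_ [l' [Hl1' Hl2']]]; [lra|lra|]. now exists l'.
Qed.

Lemma subspace_topology (T : Type) (t : opens T) (A : T -> Prop) :
  is_topology t -> is_topology (subspace t A).
Proof.
  intros Ht. split; [|split].
  - exists (fun _ => True). split; [now apply open_full|tauto].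
  - intros U V [U' [HU HU']] [V' [HV HV']]. exists (fun x => U' x /\ V' x).
    split; [now apply open_inter|]. intros y. now rewrite HU', HV'.
  - intros F HF. exists (fun x => exists U, (t U /\ exists V, F V /\ forall y, V y <-> U (proj1_sig y)) /\ U x).
    split; [apply open_union; [auto|tauto]|]. intros y. split.
    + intros [V [HV HVy]]. destruct (HF V HV) as [U [HU HUV]]. exists U.
      split; [|now apply HUV]. split; [auto|]. now exists V.
    + intros [U [[HU [V [HV HVU]]] HUy]]. exists V. split; [auto|]. now apply HVU.
Qed.

Lemma compact_set_subspace (T : Type) (t : opens T) (A : T -> Prop) :
  compact_set t A -> compact_space (subspace t A).
Proof.
  intros HA F HF Hc.
  destruct (HA (fun U => t U /\ exists V, F V /\ forall y : {x | A x}, V y <-> U (proj1_sig y)))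
    as [l [H1 H2]].
  - tauto.
  - intros x Hx. destruct (Hc (exist _ x Hx)) as [V [HV HVx]].
    destruct (HF V HV) as [U [HU HUV]]. exists U. split.
    + split; [auto|]. now exists V.
    + now apply (HUV (exist _ x Hx)).
  - destruct (@list_choice _ _ (fun U V => F V /\ forall y : {x | A x}, V y <-> U (proj1_sig y)) l)
      as [l' [H3 H4]].
    { intros U HU. now apply H1. }
    exists l'. split.
    + intros V HV. now destruct (H3 V HV) as [U [_ [? _]]].
    + intros [x Hx]. destruct (H2 x Hx) as [U [HU HUx]]. destruct (H4 U HU) as [V [HV [_ HVU]]].
      exists V. split; [auto|]. now apply HVU.
Qed.

Lemma real_subspace_hausdorff (A : R -> Prop) : hausdorff (subspace real_top A).
Proof.
  assert (H : forall x y : {r | A r}, proj1_sig x < proj1_sig y ->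
    exists U V, subspace real_top A U /\ subspace real_top A V /\ U x /\ V y /\
      (forall z, ~ (U z /\ V z))).
  { intros x y Hxy. set (m := (proj1_sig x + proj1_sig y) / 2).
    exists (fun z => proj1_sig z < m), (fun z => m < proj1_sig z).
    split; [|split; [|split; [|split]]].
    - exists (fun z => z < m). split; [apply open_lt|tauto].
    - exists (fun z => m < z). split; [apply open_gt|tauto].
    - unfold m; lra.
    - unfold m; lra.
    - intros z [H1 H2]. lra. }
  intros x y Hxy. destruct (Rtotal_order (proj1_sig x) (proj1_sig y)) as [Hl|[Hl|Hl]].
  - now apply H.
  - exfalso. apply Hxy. destruct x as [x Hx], y as [y Hy]. simpl in Hl. subst y.
    f_equal. apply proof_irrelevance.
  - destruct (H y x Hl) as [U [V [? [? [? [? Hd]]]]]]. exists V, U. repeat (split; auto).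
    intros z [? ?]. apply (Hd z); auto.
Qed.

Definition is_metric_for (X : Type) (tX : opens X) (d : X -> X -> R) : Prop :=
  (forall x y, 0 <= d x y) /\ (forall x y, d x y = 0 <-> x = y) /\
  (forall x y, d x y = d y x) /\ (forall x y z, d x z <= d x y + d y z) /\
  (forall U, tX U <-> forall x, U x -> exists eps, 0 < eps /\ forall y, d x y < eps -> U y).

Section Metric.
Variables (X : Type) (tX : opens X) (d : X -> X -> R).
Hypothesis Hd : is_metric_for tX d.

Let d_pos x y : 0 <= d x y := proj1 Hd x y.
Let d_sym x y : d x y = d y x := proj1 (proj2 (proj2 Hd)) x y.
Let d_tri x y z : d x z <= d x y + d y z := proj1 (proj2 (proj2 (proj2 Hd))) x y z.
Let d_open U := proj2 (proj2 (proj2 (proj2 Hd))) U.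

Lemma metric_refl x : d x x = 0.
Proof. now apply (proj1 (proj2 Hd)). Qed.

Lemma metric_topology : is_topology tX.
Proof.
  split; [|split].
  - apply d_open. intros x _. exists 1. split; [lra|auto].
  - intros U V HU HV. apply d_open. intros x [H1 H2].
    destruct (proj1 (d_open U) HU x H1) as [a [Ha Ha']].
    destruct (proj1 (d_open V) HV x H2) as [b [Hb Hb']].
    exists (Rmin a b). split; [now apply Rmin_pos|].
    intros y Hy. assert (H3 := Rmin_l a b). assert (H4 := Rmin_r a b).
    split; [apply Ha'|apply Hb']; lra.
  - intros F HF. apply d_open. intros x [U [HU HUx]].
    destruct (proj1 (d_open U) (HF U HU) x HUx) as [a [Ha Ha']].
    exists a. split; [auto|]. intros y Hy. exists U. auto.
Qed.

Lemma ball_open x r : tX (fun y => d x y < r).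
Proof.
  apply d_open. intros y Hy. exists (r - d x y). split; [lra|]. intros z Hz.
  assert (H := d_tri x y z). lra.
Qed.

Lemma closed_ball x r : closed tX (fun y => d x y <= r).
Proof.
  apply d_open. intros y Hy. exists (d x y - r). split; [lra|]. intros z Hz Hn.
  assert (H := d_tri x z y). rewrite (d_sym z y) in H. lra.
Qed.

Lemma metric_hausdorff : hausdorff tX.
Proof.
  intros x y Hxy.
  assert (Hp : 0 < d x y).
  { destruct (Rle_lt_or_eq_dec _ _ (d_pos x y)) as [H|H]; [auto|].
    exfalso. apply Hxy. now apply (proj1 (proj2 Hd)). }
  exists (fun z => d x z < d x y / 2), (fun z => d y z < d x y / 2).
  split; [apply ball_open|]. split; [apply ball_open|]. rewrite !metric_refl.
  split; [lra|]. split; [lra|]. intros z [H1 H2].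
  assert (H := d_tri x z y). rewrite (d_sym z y) in H. lra.
Qed.

(* The distance to A truncated at 1, so that it makes sense for empty A. *)
Lemma distance_to_set (A : X -> Prop) : exists D : X -> R,
  (forall x, 0 <= D x) /\ (forall x, A x -> D x = 0) /\
  (forall x y, Rabs (D x - D y) <= d x y) /\ (closed tX A -> forall x, ~ A x -> 0 < D x).
Proof.
  set (E := fun x r => r <= 1 /\ forall a, A a -> r <= d x a).
  assert (HE0 : forall x, E x 0).
  { intros x. split; [lra|]. auto. }
  destruct (choice (fun x r => is_lub (E x) r)) as [D HD].
  { intros x. destruct (completeness (E x)) as [m Hm].
    - exists 1. intros r [Hr _]. auto.
    - now exists 0.
    - now exists m. }
  assert (Hlip : forall x y, D y <= D x + d x y).
  { intros x y. apply (HD y). intros r [Hr1 Hr2].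
    assert (r - d x y <= D x); [|lra]. apply (HD x). split.
    - assert (H := d_pos x y). lra.
    - intros a Ha. assert (H1 := Hr2 a Ha). assert (H2 := d_tri y x a). rewrite (d_sym y x) in H2. lra. }
  assert (Hpos : forall x, 0 <= D x). { intros x. now apply (HD x). }
  exists D. split; [auto|]. split; [|split].
  - intros x Hx. apply Rle_antisym; [|auto]. apply (HD x). intros r [_ Hr].
    rewrite <- (metric_refl x). auto.
  - intros x y. assert (H1 := Hlip x y). assert (H2 := Hlip y x). rewrite (d_sym y x) in H2.
    apply Rabs_le. lra.
  - intros HA x Hx. destruct (proj1 (d_open _) HA x Hx) as [eps [He HeA]].
    apply Rlt_le_trans with (Rmin 1 eps); [apply Rmin_pos; lra|]. apply (HD x).
    split; [apply Rmin_l|]. intros a Ha. apply Rnot_lt_le. intros Hn.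
    apply (HeA a); [|auto]. assert (H := Rmin_r 1 eps). lra.
Qed.

(** The function is [D / (D + D')] for the distances to the two sets; the denominator is positive
    because the sets are closed and disjoint. *)
Lemma urysohn_metric (A A' : X -> Prop) :
  closed tX A -> closed tX A' -> (forall x, ~ (A x /\ A' x)) ->
  exists f : X -> {r : R | 0 <= r <= 1},
    continuous tX (subspace real_top (fun r => 0 <= r <= 1)) f /\
    (forall x, A x -> proj1_sig (f x) = 0) /\ (forall x, A' x -> proj1_sig (f x) = 1).
Proof.
  intros HA HA' Hdis.
  destruct (distance_to_set A) as [D [D0 [DA [DL DP]]]].
  destruct (distance_to_set A') as [D' [D0' [DA' [DL' DP']]]].
  assert (Hs : forall x, 0 < D x + D' x).
  { intros x. destruct (classic (A x)) as [Hx|Hx].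
    - assert (0 < D' x) by (apply DP'; auto; intros Hx'; apply (Hdis x); auto).
      specialize (D0 x). lra.
    - specialize (DP HA x Hx). specialize (D0' x). lra. }
  assert (Hf : forall x, 0 <= D x / (D x + D' x) <= 1).
  { intros x. specialize (Hs x). specialize (D0 x). specialize (D0' x). split.
    - apply Rmult_le_pos; [auto|]. left. now apply Rinv_0_lt_compat.
    - apply Rmult_le_reg_r with (D x + D' x); [auto|]. field_simplify; lra. }
  exists (fun x => exist _ (D x / (D x + D' x)) (Hf x)). split; [|split].
  - intros V [U [HU HUV]]. apply d_open. intros x Hx. apply HUV in Hx. simpl in Hx.
    destruct (HU _ Hx) as [eps [He HUe]].
    assert (Hsx := Hs x). set (s := D x + D' x) in *.
    (* The bound [s / 4] keeps the denominator [u] at [y] above [s / 2]. The two fractions differ by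
       at most [d x y / u], which the second bound makes smaller than [eps / 2]. *)
    exists (Rmin (s / 4) (eps * s / 4)). split.
    { apply Rmin_pos; [lra|]. assert (0 < eps * s) by now apply Rmult_lt_0_compat. lra. }
    intros y Hy. apply HUV. simpl. apply HUe.
    assert (H1 := Rmin_l (s / 4) (eps * s / 4)). assert (H2 := Rmin_r (s / 4) (eps * s / 4)).
    assert (H3 := DL x y). assert (H4 := DL' x y).
    assert (H5 := Rle_abs (D x - D y)). assert (H6 := Rle_abs (- (D x - D y))). rewrite Rabs_Ropp in H6.
    assert (H7 := Rle_abs (D' x - D' y)). assert (H8 := Rle_abs (- (D' x - D' y))). rewrite Rabs_Ropp in H8.
    assert (Hsy : s / 2 < D y + D' y) by (unfold s in *; lra).
    set (u := D y + D' y) in *.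
    replace (D x / s - D y / u) with ((D x * D' y - D y * D' x) / (s * u))
      by (unfold s, u in *; field; lra).
    assert (Hsu : 0 < s * u) by (apply Rmult_lt_0_compat; lra).
    assert (Hb : Rabs (D x * D' y - D y * D' x) <= d x y * s).
    { replace (D x * D' y - D y * D' x) with (D x * (D' y - D' x) + (D x - D y) * D' x) by ring.
      specialize (D0 x). specialize (D0' x). assert (0 <= d x y) by auto.
      unfold s. apply Rabs_le. split; nra. }
    unfold Rdiv. rewrite Rabs_mult, Rabs_inv, (Rabs_right (s * u)) by lra.
    apply Rmult_lt_reg_r with (s * u); [auto|].
    rewrite Rmult_assoc, Rinv_l, Rmult_1_r by lra.
    apply Rle_lt_trans with (1 := Hb). 
    assert (d x y < eps * s / 4) by lra.
    assert (d x y * s < eps * s / 4 * s) by (apply Rmult_lt_compat_r; lra).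
    assert (0 < eps * s) by now apply Rmult_lt_0_compat.
    assert (eps * s * (s / 2) < eps * s * u) by (apply Rmult_lt_compat_l; lra).
    assert (0 < eps * s * s) by now apply Rmult_lt_0_compat.
    lra.
  - intros x Hx. simpl. rewrite (DA x Hx). unfold Rdiv. ring.
  - intros x Hx. simpl. specialize (Hs x). rewrite (DA' x Hx) in *. field. lra.
Qed.

(** A Urysohn function extends to [K] by the universal property. Its value at [q] is above [/ 3],
    which excludes the closure of [A], or below [2 / 3], which excludes that of [A']. *)
Lemma closed_disjoint_closures (K : Type) (tK : opens K) (e : X -> K) (A A' : X -> Prop) :
  is_StoneCech tX tK e -> closed tX A -> closed tX A' -> (forall x, ~ (A x /\ A' x)) ->
  forall q, ~ (closure tK (fun p => exists x, A x /\ e x = p) q /\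
               closure tK (fun p => exists x, A' x /\ e x = p) q).
Proof.
  intros Hsc HA HA' Hdis q [H1 H2].
  destruct (urysohn_metric HA HA' Hdis) as [f [Hf [Hf0 Hf1]]].
  destruct (proj2 (proj2 (proj2 (proj2 (proj2 Hsc)))) _ (subspace real_top (fun r => 0 <= r <= 1))
    (subspace_topology _ real_top_topology) (compact_set_subspace unit_interval_compact)
    (@real_subspace_hausdorff _) f Hf) as [g [Hg Hgf]].
  destruct (Rlt_dec (/ 3) (proj1_sig (g q))) as [Hq|Hq].
  - destruct (H1 (fun p => / 3 < proj1_sig (g p))) as [p [Hp [x [Hx <-]]]].
    + apply (Hg (fun y => / 3 < proj1_sig y)). exists (fun y => / 3 < y). split; [apply open_gt|tauto].
    + auto.
    + rewrite Hgf, (Hf0 x Hx) in Hp. lra.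
  - destruct (H2 (fun p => proj1_sig (g p) < 2 / 3)) as [p [Hp [x [Hx <-]]]].
    + apply (Hg (fun y => proj1_sig y < 2 / 3)). exists (fun y => y < 2 / 3). split; [apply open_lt|tauto].
    + lra.
    + rewrite Hgf, (Hf1 x Hx) in Hp. lra.
Qed.

End Metric.

(** * Gluing along a discrete family *)

Definition discrete_family (X : Type) (tX : opens X) (B : nat -> X -> Prop) : Prop :=
  forall x, exists O m, tX O /\ O x /\ forall n y, O y -> B n y -> n = m.

Section Glue.
Variables (X : Type) (tX : opens X).
Hypothesis HtX : is_topology tX.
Variable B : nat -> X -> Prop.
Hypothesis B_discrete : discrete_family tX B.

Definition glue (f : nat -> X -> X) (x : X) : X :=
  match excluded_middle_informative (exists n, B n x) with
  | left h => f (proj1_sig (constructive_indefinite_description _ h)) x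
  | right _ => x
  end.

Lemma discrete_disjoint n m x : B n x -> B m x -> n = m.
Proof.
  intros Hn Hm. destruct (B_discrete x) as [O [k [_ [HO Hk]]]].
  rewrite (Hk n x HO Hn). symmetry. now apply (Hk m x).
Qed.

Lemma glue_in f n x : B n x -> glue f x = f n x.
Proof.
  intros Hn. unfold glue. destruct (excluded_middle_informative _) as [h|h].
  - destruct (constructive_indefinite_description _ h) as [m Hm]. simpl.
    now rewrite (discrete_disjoint Hn Hm).
  - exfalso. apply h. now exists n.
Qed.

Lemma glue_out f x : (forall n, ~ B n x) -> glue f x = x.
Proof.
  intros Hn. unfold glue. destruct (excluded_middle_informative _) as [[n h]|h]; [|auto].
  exfalso. now apply (Hn n).
Qed.

(** A small neighbourhood meets at most the block [B m], and on it [glue f] coincides with [f m],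
    also off [B m], where both are the identity. *)
Lemma glue_continuous f : (forall n, continuous tX tX (f n)) ->
  (forall n x, ~ B n x -> f n x = x) -> continuous tX tX (glue f).
Proof.
  intros Hf Hid V HV. apply (open_locally HtX). intros x Hx.
  destruct (B_discrete x) as [O [m [HO [HOx Hm]]]].
  assert (Heq : forall y, O y -> glue f y = f m y).
  { intros y Hy. destruct (classic (exists n, B n y)) as [[n Hn]|Hn].
    - rewrite (glue_in f Hn). now rewrite (Hm n y Hy Hn).
    - rewrite glue_out; [|intros n Hn'; apply Hn; now exists n].
      symmetry. apply Hid. intros Hn'. apply Hn. now exists m. }
  exists (fun y => O y /\ V (f m y)). split; [|split].
  - apply open_inter; [auto|auto|]. exact (Hf m V HV).
  - split; [auto|]. now rewrite <- Heq.
  - intros y [Hy1 Hy2]. now rewrite Heq.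
Qed.

(** A point sent out of [B0] would have a fixed image, and injectivity would make the point equal to
    that image. *)
Lemma supported_stable (B0 : X -> Prop) r x : supported tX B0 r -> B0 x -> B0 (fst r x).
Proof.
  intros [_ [_ [H1 [_ H2]]]] Hx. apply NNPP. intros Hn.
  assert (H := H2 _ Hn). apply (f_equal (snd r)) in H. rewrite !H1 in H.
  rewrite H in Hn. auto.
Qed.

Lemma supported_inverse (B0 : X -> Prop) r :
  supported tX B0 r -> supported tX B0 (snd r, fst r).
Proof.
  intros [H1 [H2 [H3 [H4 H5]]]]. repeat (split; [assumption|]).
  intros x Hx. simpl. rewrite <- (H5 x Hx) at 1. apply H3.
Qed.

Lemma glue_inverse (r : nat -> aut X) : (forall n, supported tX (B n) (r n)) ->
  forall x, glue (fun n => snd (r n)) (glue (fun n => fst (r n)) x) = x.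
Proof.
  intros Hr x. destruct (classic (exists n, B n x)) as [[n Hn]|Hn].
  - rewrite (glue_in _ Hn). rewrite (glue_in _ (n := n)).
    + now apply (Hr n).
    + now apply supported_stable.
  - assert (Ho : forall n, ~ B n x) by (intros n Hn'; apply Hn; now exists n).
    now rewrite !glue_out by (try rewrite glue_out; auto).
Qed.

Lemma discrete_union_closed (C : nat -> X -> Prop) (P : nat -> Prop) :
  (forall n, P n -> closed tX (C n)) -> (forall n, P n -> forall x, C n x -> B n x) ->
  closed tX (fun x => exists n, P n /\ C n x).
Proof.
  intros HC HCB. apply (open_locally HtX). intros x Hx.
  destruct (B_discrete x) as [O [m [HO [HOx Hm]]]].
  destruct (classic (P m)) as [HP|HP].
  - exists (fun y => O y /\ ~ C m y). split; [|split].
    + apply open_diff; auto.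
    + split; [auto|]. intros Hc. apply Hx. now exists m.
    + intros y [Hy1 Hy2] [n [Hn Hcn]].
      rewrite (Hm n y Hy1 (HCB n Hn y Hcn)) in Hcn. auto.
  - exists O. split; [auto|]. split; [auto|]. intros y Hy [n [Hn Hcn]].
    rewrite (Hm n y Hy (HCB n Hn y Hcn)) in Hn. auto.
Qed.

End Glue.

(** Two branches are told apart at a cluster point [q] in the remainder of the points [p n] which
    one branch moves into [C n] and the other into [C' n]: the limits send [q] into the closures of
    two disjoint closed sets of [X]. *)
Lemma tower_homeomorphisms (X : Type) (tX : opens X) (d : X -> X -> R)
  (K : Type) (tK : opens K) (e : X -> K) (B : nat -> X -> Prop)
  (I : Type) (lt : I -> I -> Prop) (code : I -> (X -> Prop) * (X -> Prop)) :
  is_metric_for tX d -> locally_compact tX -> is_StoneCech tX tK e ->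
  (forall n, compact_set tX (B n)) -> discrete_family tX B ->
  (exists s, good tX B s) ->
  inhabited I -> well_founded lt -> (forall a b c, lt a b -> lt b c -> lt a c) ->
  (forall a b, lt a b \/ a = b \/ lt b a) ->
  (forall a, exists u : nat -> I, forall b, lt b a -> exists n, u n = b) ->
  (forall A, closed_disjoint tX A -> exists a, code a = A) ->
  exists Psi : (I -> bool) -> {phi : Xstar e -> Xstar e |
      homeomorphism (Xstar_top tK e) (Xstar_top tK e) phi},
    forall x y, Psi x = Psi y -> x = y.
Proof.
  intros Hd Hlc Hsc HBc HBd Hgood Iinh Hwf Htr Htot Hcnt Hcode.
  assert (HtX := metric_topology Hd).
  destruct (tower_exists HtX Hwf Htr Htot Hcnt code Hgood) as [T [T1 [T2 [T3 T4]]]].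
  set (le := fun a b => a = b \/ lt a b).
  assert (le_refl : forall a, le a a) by (intros; left; auto).
  assert (le_trans : forall a b c, le a b -> le b c -> le a c).
  { intros a b c [->|H1] [->|H2]; unfold le; eauto. }
  assert (le_total : forall a b, le a b \/ le b a).
  { intros a b. unfold le. destruct (Htot a b) as [|[|]]; auto. }
  assert (Tle : forall x a b, le a b -> almost_sub (T x b) (T x a)).
  { intros x a b [->|H]; [apply almost_sub_refl|auto]. }
  (* One homeomorphism is picked on every [B n]. For the finitely many [n] where [T x a n] fails to
     have norm [0] the identity is the default, so that gluing is always possible. *)
  destruct (choice (fun (xa : (I -> bool) * I) (r : nat -> aut X) =>
    (forall n, supported tX (B n) (r n)) /\ eventually (fun n => T (fst xa) (snd xa) n (r n))))
    as [r Hr].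
  { intros [x a]. simpl.
    destruct (choice (fun n (r : aut X) => supported tX (B n) r /\
      (large tX (B n) 0 (T x a n) -> T x a n r))) as [r Hr].
    - intros n. destruct (classic (large tX (B n) 0 (T x a n))) as [Hl|Hl].
      + destruct (large_inhabited Hl) as [r Hr]. exists r. split; [|auto].
        now apply (large_supported Hl).
      + exists (fun x => x, fun x => x). split; [|tauto].
        repeat (split; [try apply continuous_id; auto|]). auto.
    - exists r. split; [intros n; apply Hr|].
      generalize (T1 x a 0%nat). apply eventually_mono. intros n. apply Hr. }
  set (Phi := fun x a => glue B (fun n => fst (r (x, a) n))).
  set (Phi' := fun x a => glue B (fun n => snd (r (x, a) n))).
  assert (Hsup : forall x a n, supported tX (B n) (r (x, a) n)) by (intros; apply (Hr (x, a))).
  assert (Hin : forall x a b, le a b -> eventually (fun n => T x a n (r (x, b) n))).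
  { intros x a b Hab. generalize (eventually_and (Tle x a b Hab) (proj2 (Hr (x, b)))).
    apply eventually_mono. intros n [H1 H2]. now apply H1. }
  assert (Hcoh : forall x, coherent tX le (Phi x) /\ coherent tX le (Phi' x)).
  { intros x. split; intros A A' HA HA' Hdis;
      (destruct (Hcode (A, A')) as [a Ha]; [now split|]);
      assert (HD := T3 x a); rewrite Ha in HD; simpl in HD;
      exists a; intros b c Hb Hc;
      (destruct (eventually_and (HD (conj HA (conj HA' Hdis)))
        (eventually_and (Hin x a b Hb) (Hin x a c Hc))) as [N HN]);
      (* The exceptional compact set consists of the blocks on which the tower has not settled yet.
         Outside all blocks both maps are the identity, and disjointness of [A] and [A'] is
         enough. *)
      exists (fun y => exists n, (n < N)%nat /\ B n y);
      (split; [apply compact_bounded_union; auto|]);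
      intros y Hy;
      (destruct (classic (exists n, B n y)) as [[n Hn]|Hn];
      [ unfold Phi, Phi'; rewrite !(glue_in HBd _ Hn);
        (assert (HNn : (N <= n)%nat);
        [ apply Nat.nlt_ge; intros Hl; apply Hy; now exists n
        | destruct (HN n HNn) as [H1 [H2 H3]]; now apply (H1 _ _ y H2 H3 Hn)])
      | assert (Ho : forall n, ~ B n y) by (intros n Hn'; apply Hn; now exists n);
        unfold Phi, Phi'; rewrite !(glue_out _ Ho); apply Hdis ]). }
  assert (Hlim := fun x => limit_homeomorphism Hsc le_refl le_trans le_total Iinh
    (Phi := Phi x) (Phi' := Phi' x) Hlc
    (fun a => glue_continuous HtX HBd (fun n => proj1 (Hsup x a n))
       (fun n => proj2 (proj2 (proj2 (proj2 (Hsup x a n))))))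
    (fun a => glue_continuous HtX HBd (fun n => proj1 (proj2 (Hsup x a n)))
       (fun n => proj2 (proj2 (proj2 (proj2 (supported_inverse (Hsup x a n)))))))
    (fun a => glue_inverse HBd (Hsup x a))
    (fun a => glue_inverse HBd (r := fun n => (snd (r (x, a) n), fst (r (x, a) n)))
       (fun n => supported_inverse (Hsup x a n)))
    (proj1 (Hcoh x)) (proj2 (Hcoh x))).
  destruct (choice _ Hlim) as [bF HbF]. destruct (choice _ HbF) as [psi Hpsi].
  exists (fun x => exist _ (psi x) (proj1 (proj2 (proj2 (Hpsi x))))).
  intros x y Hxy. apply NNPP. intros Hne. apply (f_equal (@proj1_sig _ _)) in Hxy. simpl in Hxy.
  destruct (T4 x y Hne) as [a [N HN]].
  assert (HN' : forall n, exists pCC : X * (X -> Prop) * (X -> Prop), (N <= n)%nat ->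
    let p := fst (fst pCC) in let C := snd (fst pCC) in let C' := snd pCC in
    B n p /\ closed tX C /\ closed tX C' /\
    (forall x, C x -> B n x) /\ (forall x, C' x -> B n x) /\ (forall x, ~ (C x /\ C' x)) /\
    (forall r, T x a n r -> C (fst r p)) /\ (forall r, T y a n r -> C' (fst r p))).
  { intros n. destruct (Nat.le_gt_cases N n) as [Hn|Hn].
    - destruct (HN n Hn) as [p [C [C' H]]]. exists (p, C, C'). simpl. auto.
    - destruct (HN N (le_n N)) as [p _]. exists (p, fun _ => False, fun _ => False). intros Hc. lia. }
  destruct (choice _ HN') as [pCC HP]. simpl in HP. clear HN HN'.
  set (p := fun n => fst (fst (pCC n))) in *.
  set (C := fun n => snd (fst (pCC n))) in *. set (C' := fun n => snd (pCC n)) in *.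
  assert (HC1 : closed tX (fun z => exists n, (N <= n)%nat /\ C n z)).
  { apply (discrete_union_closed HtX HBd); intros n Hn; now apply (HP n Hn). }
  assert (HC2 : closed tX (fun z => exists n, (N <= n)%nat /\ C' n z)).
  { apply (discrete_union_closed HtX HBd); intros n Hn; now apply (HP n Hn). }
  assert (HC3 : forall z, ~ ((exists n, (N <= n)%nat /\ C n z) /\ (exists n, (N <= n)%nat /\ C' n z))).
  { intros z [[n [Hn Hz]] [m [Hm Hz']]].
    destruct (HP n Hn) as [_ [_ [_ [H1 [_ [H2 _]]]]]]. destruct (HP m Hm) as [_ [_ [_ [_ [H3 _]]]]].
    rewrite <- (discrete_disjoint HBd (H1 z Hz) (H3 z Hz')) in Hz'. exact (H2 z (conj Hz Hz')). }
  (* With index order [nat] and constant maps, evaluated at an arbitrary point, this is a cluster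
     point of the sequence [e (p n)]. *)
  destruct (cluster_exists Hsc Nat.le_refl Nat.le_trans Nat.le_ge_cases
    (inhabits 0%nat) (fun n _ => e (p n)) (e (p 0%nat))) as [q Hq].
  (* Some neighbourhood of a point of [X] meets no block except [B m], whereas a cluster point is
     approached by [p n] in [B n] with [n > m]. *)
  assert (Hqr : remainder e q).
  { intros [z Hz]. destruct (HBd z) as [O [m [HO [HOz Hm]]]].
    destruct (proj2 (proj2 (proj1 (proj2 (proj2 (proj2 Hsc))))) O HO) as [V [HV HOV]].
    assert (HVq : V q) by (rewrite <- Hz; now apply HOV).
    destruct (Hq V HV HVq (S (max N m))) as [n [Hn Hpn]].
    assert (Hnm : n = m); [|lia]. apply (Hm n (p n)).
    - now apply HOV.
    - assert (HNn : (N <= n)%nat) by lia. exact (proj1 (HP n HNn)). }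
  (* A late [bF z b] sends [q] near [psi z q], and by continuity also some [e (p n)], with [n] so
     large that the homeomorphism picked on [B n] at stage [b] belongs to [T z a n] and hence moves
     [p n] into [Cz n]. *)
  assert (Hclos : forall z (Cz : nat -> X -> Prop),
    (forall n, (N <= n)%nat -> B n (p n) /\ forall r, T z a n r -> Cz n (fst r (p n))) ->
    closure tK (fun k => exists v, (exists n, (N <= n)%nat /\ Cz n v) /\ e v = k)
      (proj1_sig (psi z (exist _ q Hqr)))).
  { intros z Cz HCz U HU HUq. destruct (Hpsi z) as [E1 [E2 [_ E3]]].
    destruct (E3 (exist _ q Hqr) U HU HUq) as [a' Ha']. simpl in Ha'.
    assert (Hb : exists b, le a b /\ le a' b).
    { destruct (le_total a a'); [exists a'|exists a]; auto. }
    destruct Hb as [b [Hab Hab']].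
    destruct (Hin z a b Hab) as [M HM].
    destruct (Hq (fun k => U (bF z b k)) (E2 b U HU) (Ha' b Hab') (max N M)) as [n [Hn HUn]].
    rewrite E1 in HUn. exists (e (Phi z b (p n))). split; [auto|].
    exists (Phi z b (p n)). split; [|auto]. exists n. split; [lia|].
    destruct (HCz n) as [H1 H2]; [lia|].
    unfold Phi. rewrite (glue_in HBd _ H1). apply H2. apply HM. lia. }
  apply (closed_disjoint_closures Hd Hsc HC1 HC2 HC3 (q := proj1_sig (psi x (exist _ q Hqr)))).
  split.
  - apply Hclos. intros n Hn. destruct (HP n Hn) as [H1 [_ [_ [_ [_ [_ [H2 H3]]]]]]]. now split.
  - rewrite Hxy. apply Hclos. intros n Hn. destruct (HP n Hn) as [H1 [_ [_ [_ [_ [_ [H2 H3]]]]]]]. now split.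
Qed.

(** * Placing large sets of homeomorphisms along a discrete family *)

Lemma inv_INR_small eps : 0 < eps -> exists m : nat, / INR (S m) < eps.
Proof.
  intros He. destruct (archimed_cor1 eps He) as [N [HN HN0]].
  exists (pred N). now replace (S (pred N)) with N by lia.
Qed.

Lemma dense_ball (X : Type) (tX : opens X) (d : X -> X -> R) (s : nat -> X) :
  is_metric_for tX d -> dense tX (fun x => exists k, s k = x) ->
  forall x eps, 0 < eps -> exists i m, d (s i) x < / INR (S m) /\
    forall z, d (s i) z < / INR (S m) -> d x z < eps.
Proof.
  intros Hd Hs x eps He.
  destruct (@inv_INR_small (eps / 2)) as [m Hm]; [lra|].
  assert (Hm0 : 0 < / INR (S m)) by (apply Rinv_0_lt_compat, lt_0_INR; lia).
  destruct (Hs _ (ball_open Hd x (/ INR (S m)))) as [y [Hy [i <-]]].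
  { exists x. now rewrite (metric_refl Hd). }
  destruct Hd as [_ [_ [Hds [Hdt _]]]].
  exists i, m. split; [now rewrite Hds|]. intros z Hz. assert (H := Hdt x (s i) z). lra.
Qed.

(** The balls of radius [/ INR (S m)] about the dense sequence, indexed through the pairing of
    [nat], form a base; those inside a compact set already cover [X], and the remaining indices
    receive empty sets. *)
Lemma compact_cover (X : Type) (tX : opens X) (d : X -> X -> R) :
  is_metric_for tX d -> separable tX -> locally_compact tX ->
  exists O C : nat -> X -> Prop,
    (forall n, tX (O n)) /\ (forall n, compact_set tX (C n)) /\
    (forall n x, O n x -> C n x) /\ (forall x, exists n, O n x).
Proof.
  intros Hd [s Hs] Hlc.
  set (b := fun n x => d (s (fst (of_nat n))) x < / INR (S (snd (of_nat n)))).
  destruct (choice (fun n (OC : (X -> Prop) * (X -> Prop)) =>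
    tX (fst OC) /\ compact_set tX (snd OC) /\ (forall x, fst OC x -> snd OC x) /\
    ((exists C, compact_set tX C /\ forall x, b n x -> C x) -> fst OC = b n))) as [OC HOC].
  { intros n. destruct (classic (exists C, compact_set tX C /\ forall x, b n x -> C x)) as [[C [H1 H2]]|H].
    - exists (b n, C). simpl. split; [apply (ball_open Hd)|]. auto.
    - exists (fun _ => False, fun _ => False). simpl.
      split; [apply (open_const (metric_topology Hd))|].
      split; [apply compact_empty|]. tauto. }
  exists (fun n => fst (OC n)), (fun n => snd (OC n)).
  split; [intros n; apply HOC|]. split; [intros n; apply HOC|]. split; [intros n; apply HOC|].
  intros x. destruct (Hlc x) as [U [C [HU [HUx [HUC HC]]]]]. apply compact_subspace in HC.
  destruct (proj1 (proj2 (proj2 (proj2 (proj2 Hd))) U) HU x HUx) as [eps [He HeU]].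
  destruct (dense_ball Hd Hs x He) as [i [m [Hi Hm]]].
  exists (to_nat (i, m)). rewrite (proj2 (proj2 (proj2 (HOC _)))).
  - unfold b. now rewrite cancel_of_to.
  - exists C. split; [auto|]. intros z Hz. unfold b in Hz. rewrite cancel_of_to in Hz.
    apply HUC, HeU. now apply Hm.
Qed.

(** The compact set [H n] contains [C 0] to [C n] and all earlier blocks, and [B n] is chosen
    outside it with norm [n]. Hence the blocks are disjoint and [O j] meets only blocks of index
    below [j]. *)
Lemma discrete_gadgets (X : Type) (tX : opens X) (d : X -> X -> R) :
  is_metric_for tX d -> separable tX -> locally_compact tX ->
  (forall k C, compact_set tX C -> exists B S,
     compact_set tX B /\ (forall x, B x -> ~ C x) /\ large tX B k S) ->
  exists B, (forall n, compact_set tX (B n)) /\ discrete_family tX B /\ exists s, good tX B s.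
Proof.
  intros Hd Hsep Hlc Hgad. assert (HtX := metric_topology Hd).
  destruct (compact_cover Hd Hsep Hlc) as [O [C [HO [HC [HOC Hcov]]]]].
  destruct (choice (fun (kC : nat * (X -> Prop)) (BS : (X -> Prop) * (aut X -> Prop)) =>
    compact_set tX (snd kC) -> compact_set tX (fst BS) /\
    (forall x, fst BS x -> ~ snd kC x) /\ large tX (fst BS) (fst kC) (snd BS))) as [gad Hg].
  { intros [k C0]. simpl. destruct (classic (compact_set tX C0)) as [H|H].
    - destruct (Hgad k C0 H) as [B [S HBS]]. exists (B, S). auto.
    - exists (C0, fun _ => True). tauto. }
  set (H := fix H (n : nat) : X -> Prop := match n with
    | 0%nat => C 0%nat
    | S n => fun x => (H n x \/ fst (gad (n, H n)) x) \/ C (S n) x end).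
  assert (HH : forall n, compact_set tX (H n)).
  { induction n as [|n IH]; [apply HC|]. simpl. apply compact_or; [apply compact_or|apply HC].
    - exact IH.
    - now apply (Hg (n, H n)). }
  set (B := fun n => fst (gad (n, H n))).
  assert (HB := fun n => Hg (n, H n) (HH n)). simpl in HB.
  assert (Hmono : forall n m x, (n <= m)%nat -> H n x -> H m x).
  { intros n m x Hnm Hx. induction Hnm; [auto|]. simpl. auto. }
  assert (HBH : forall n m x, (n < m)%nat -> B n x -> H m x).
  { intros n m x Hnm Hx. apply Hmono with (S n); [lia|]. simpl. auto. }
  assert (HCH : forall n m x, (n <= m)%nat -> C n x -> H m x).
  { intros n m x Hnm Hx. apply Hmono with n; [lia|]. destruct n; simpl; auto. }
  assert (Hdis : forall n m x, B n x -> B m x -> n = m).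
  { intros n m x Hn Hm. destruct (Nat.lt_total n m) as [Hl|[Hl|Hl]]; [|auto|]; exfalso.
    - apply (proj1 (proj2 (HB m)) x Hm). now apply HBH with n.
    - apply (proj1 (proj2 (HB n)) x Hn). now apply HBH with m. }
  exists B. split; [intros n; apply HB|]. split.
  - intros x. destruct (Hcov x) as [j Hj].
    assert (Hm : exists m, forall n, B n x -> n = m).
    { destruct (classic (exists m, B m x)) as [[m Hm]|Hn].
      - exists m. intros n Hn. now apply Hdis with x.
      - exists 0%nat. intros n Hn'. exfalso. apply Hn. now exists n. }
    destruct Hm as [m Hm].
    (* The finitely many earlier blocks that miss [x] are removed; being compact, they are
       closed. *)
    exists (fun y => O j y /\ forall n, (n < j)%nat -> B n x \/ ~ B n y), m.
    split; [|split].
    + apply open_inter; [auto|auto|]. apply (@open_bounded_inter _ _ HtX (fun n y => B n x \/ ~ B n y)).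
      intros n _. destruct (classic (B n x)) as [Hx|Hx].
      * apply (open_ext (open_full HtX)). tauto.
      * assert (Hc : closed tX (B n)) by (apply (compact_closed HtX (metric_hausdorff Hd)); apply HB).
        refine (@open_ext _ _ (fun y => ~ B n y) _ Hc _). tauto.
    + split; [auto|]. intros n _. tauto.
    + intros n y [Hy1 Hy2] Hny. apply Hm.
      destruct (Nat.lt_ge_cases n j) as [Hl|Hl].
      * destruct (Hy2 n Hl); tauto.
      * exfalso. apply (proj1 (proj2 (HB n)) y Hny). apply HCH with j; auto.
  - exists (fun n => snd (gad (n, H n))). intros k. exists k. intros n Hn.
    apply large_le with n; [auto|]. apply HB.
Qed.

Lemma noncompact_escapes (X : Type) (tX : opens X) C :
  ~ compact_space tX -> compact_set tX C -> exists x, ~ C x.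
Proof.
  intros Hn HC. apply NNPP. intros H. apply Hn. apply compact_space_set.
  replace (fun _ : X => True) with C; [auto|]. apply pred_ext. intros x. split; [auto|].
  intros _. apply NNPP. intros Hx. apply H. now exists x.
Qed.

(** * Isotopies *)

Definition jointly_continuous (X : Type) (tX : opens X) (F : R -> X -> X) : Prop :=
  forall s x O, 0 <= s <= 1 -> tX O -> O (F s x) ->
  exists delta O', 0 < delta /\ tX O' /\ O' x /\
    forall s' y, 0 <= s' <= 1 -> Rabs (s' - s) < delta -> O' y -> O (F s' y).

(** A tube argument: [F a x] misses [A] or [A'], and the same set is missed by [F s y] for all [s]
    near [a] and [y] near [x]. Finitely many such neighbourhoods cover [B]. *)
Lemma jointly_continuous_decides (X : Type) (tX : opens X) (F : R -> X -> X) B A A' a :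
  jointly_continuous tX F -> compact_set tX B ->
  closed tX A -> closed tX A' -> (forall x, ~ (A x /\ A' x)) -> 0 <= a <= 1 ->
  exists delta, 0 < delta /\ forall s s' x, 0 <= s <= 1 -> 0 <= s' <= 1 ->
    Rabs (s - a) < delta -> Rabs (s' - a) < delta -> B x -> ~ (A (F s x) /\ A' (F s' x)).
Proof.
  intros HF HB HA HA' Hd Ha.
  set (Q := fun delta (O : X -> Prop) => 0 < delta /\ forall s s' x, 0 <= s <= 1 -> 0 <= s' <= 1 ->
    Rabs (s - a) < delta -> Rabs (s' - a) < delta -> O x -> ~ (A (F s x) /\ A' (F s' x))).
  destruct (HB (fun O => tX O /\ exists delta, Q delta O)) as [l [H1 H2]].
  - tauto.
  - intros x _. destruct (classic (A (F a x))) as [Hx|Hx].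
    + assert (Hx' : ~ A' (F a x)) by (intros H; apply (Hd (F a x)); auto).
      destruct (HF a x _ Ha HA' Hx') as [delta [O [H1 [H2 [H3 H4]]]]].
      exists O. split; [|auto]. split; [auto|]. exists delta. split; [auto|].
      intros s s' y Hs Hs' Hsa Hsa' Hy [_ H5]. exact (H4 s' y Hs' Hsa' Hy H5).
    + destruct (HF a x _ Ha HA Hx) as [delta [O [H1 [H2 [H3 H4]]]]].
      exists O. split; [|auto]. split; [auto|]. exists delta. split; [auto|].
      intros s s' y Hs Hs' Hsa Hsa' Hy [H5 _]. exact (H4 s y Hs Hsa Hy H5).
  - assert (Hmin : exists delta, 0 < delta /\ forall O, In O l -> Q delta O).
    { clear H2. induction l as [|O l IH].
      - exists 1. split; [lra|]. simpl; tauto.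
      - destruct IH as [e [He IH]]; [intros; apply H1; simpl; auto|].
        destruct (H1 O (or_introl eq_refl)) as [_ [e' [He' Hq]]].
        exists (Rmin e e'). split; [now apply Rmin_pos|].
        assert (R1 := Rmin_l e e'). assert (R2 := Rmin_r e e').
        intros O' [<-|HO].
        + split; [now apply Rmin_pos|]. intros; apply Hq; auto; lra.
        + split; [now apply Rmin_pos|]. intros; apply (IH O' HO); auto; lra. }
    destruct Hmin as [delta [Hpos Hq]]. exists delta. split; [auto|].
    intros s s' x Hs Hs' Hsa Hsa' Hx. destruct (H2 x Hx) as [O [HO HOx]].
    now apply (Hq O HO).
Qed.

(** A decision shrinks the interval of parameters to a short one at its left end, chosen for the
    isotopy and its inverse together; a split keeps the two outer thirds, which the separation
    hypothesis holds apart at [p]. Both leave nondegenerate intervals, so the induction on [k] is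
    over all of them. *)
Lemma isotopy_large (X : Type) (tX : opens X) (F G : R -> X -> X) B p :
  is_topology tX -> compact_set tX B ->
  jointly_continuous tX F -> jointly_continuous tX G ->
  (forall s x, 0 <= s <= 1 -> G s (F s x) = x) -> (forall s x, 0 <= s <= 1 -> F s (G s x) = x) ->
  (forall s x, 0 <= s <= 1 -> ~ B x -> F s x = x) -> B p ->
  (forall a b, 0 <= a -> a < b -> b <= 1 -> exists C C', closed tX C /\ closed tX C' /\
    (forall x, C x -> B x) /\ (forall x, C' x -> B x) /\ (forall x, ~ (C x /\ C' x)) /\
    (forall s, 0 <= s <= a -> C (F s p)) /\ (forall s, b <= s <= 1 -> C' (F s p))) ->
  forall k a b, 0 <= a -> a < b -> b <= 1 ->
  large tX B k (fun r => exists s, a <= s <= b /\ r = (F s, G s)).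
Proof.
  intros HtX HB HF HG HGF HFG Hoff Hp Hsep.
  assert (Hcont : forall H s, jointly_continuous tX H -> 0 <= s <= 1 -> continuous tX tX (H s)).
  { intros H s HH Hs V HV. apply (open_locally HtX). intros x Hx.
    destruct (HH s x V Hs HV Hx) as [delta [O [Hd [HO [HOx HO']]]]].
    exists O. split; [auto|]. split; [auto|]. intros y Hy. apply HO'; auto.
    rewrite Rminus_diag, Rabs_R0. auto. }
  assert (Hbase : forall a b, 0 <= a -> a < b -> b <= 1 ->
    (exists r, exists s, a <= s <= b /\ r = (F s, G s)) /\
    (forall r, (exists s, a <= s <= b /\ r = (F s, G s)) -> supported tX B r)).
  { intros a b Ha Hab Hb. split.
    - exists (F a, G a), a. split; [lra|auto].
    - intros r [s [Hs ->]]. assert (Hs1 : 0 <= s <= 1) by lra.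
      split; [now apply Hcont|]. split; [now apply Hcont|]. simpl. auto. }
  induction k as [|k IH]; intros a b Ha Hab Hb.
  - destruct (Hbase a b Ha Hab Hb). simpl. auto.
  - destruct (Hbase a b Ha Hab Hb) as [Hb1 Hb2].
    split; [exact Hb1|]. split; [exact Hb2|]. split.
    + intros A A' HA HA' Hd.
      destruct (@jointly_continuous_decides X tX F B A A' a) as [e [He He1]]; auto; [lra|].
      destruct (@jointly_continuous_decides X tX G B A A' a) as [f [Hf Hf1]]; auto; [lra|].
      (* Halving keeps the closed interval from [a] to [c] strictly within both radii. *)
      set (c := Rmin b (a + Rmin e f / 2)).
      assert (R1 := Rmin_l e f). assert (R2 := Rmin_r e f).
      assert (R3 : 0 < Rmin e f) by now apply Rmin_pos.
      assert (R4 : c <= b) by apply Rmin_l. assert (R5 : c <= a + Rmin e f / 2) by apply Rmin_r.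
      assert (R6 : a < c) by (apply Rmin_glb_lt; lra).
      exists (fun r => exists s, a <= s <= c /\ r = (F s, G s)). split; [|split].
      * intros r [s [Hs ->]]. exists s. split; [lra|auto].
      * apply IH; lra.
      * intros r r' x [s [Hs ->]] [s' [Hs' ->]] Hx. simpl.
        split; [apply He1|apply Hf1]; auto; try lra; apply Rabs_def1; lra.
    + set (t := (b - a) / 3). destruct (Hsep (a + t) (b - t)) as [C [C' [H1 [H2 [H3 [H4 [H5 [H6 H7]]]]]]]];
        [unfold t; lra|unfold t; lra|unfold t; lra|].
      exists (fun r => exists s, a <= s <= a + t /\ r = (F s, G s)),
        (fun r => exists s, b - t <= s <= b /\ r = (F s, G s)).
      split; [|split; [|split; [|split]]].
      * intros r [s [Hs ->]]. exists s. split; [unfold t in Hs; lra|auto].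
      * intros r [s [Hs ->]]. exists s. split; [unfold t in Hs; lra|auto].
      * apply IH; unfold t; lra.
      * apply IH; unfold t; lra.
      * exists p, C, C'. repeat (split; [assumption|]). split.
        -- intros r [s [Hs ->]]. apply H6. lra.
        -- intros r [s [Hs ->]]. apply H7. lra.
Qed.

(** * An isotopy of Euclidean space supported in a box *)

(** The projection of the line onto the unit interval, written with absolute values so that its
    continuity reduces to that of [Rabs]. *)
Definition clamp (x : R) : R := (1 + Rabs x - Rabs (x - 1)) / 2.

Lemma clamp_cases x : (x <= 0 /\ clamp x = 0) \/ (0 <= x <= 1 /\ clamp x = x) \/ (1 <= x /\ clamp x = 1).
Proof.
  unfold clamp, Rabs. destruct (Rcase_abs x), (Rcase_abs (x - 1)); lra.
Qed.

(** The displacement of the Moebius map taking [m] to [m / (m + c * (1 - m))], which fixes [0] and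
    [1]. Unlike the map itself, a displacement extends beyond the interval by [0], through
    [clamp]. *)
Definition push (c m : R) : R := m / (m + c * (1 - m)) - m.

Lemma push_denominator c m : 0 < c -> 0 <= m <= 1 -> 0 < m + c * (1 - m).
Proof.
  intros Hc Hm. destruct (Req_dec m 0) as [->|]; [lra|].
  assert (0 <= c * (1 - m)) by (apply Rmult_le_pos; lra). lra.
Qed.

Lemma push_bounds c m : 0 < c -> 0 <= m <= 1 -> 0 <= m + push c m <= 1.
Proof.
  intros Hc Hm. assert (H := push_denominator Hc Hm). unfold push.
  replace (m + (m / (m + c * (1 - m)) - m)) with (m / (m + c * (1 - m))) by ring. split.
  - apply Rmult_le_pos; [lra|]. left. now apply Rinv_0_lt_compat.
  - apply Rmult_le_reg_r with (m + c * (1 - m)); [auto|]. unfold Rdiv.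
    rewrite Rmult_assoc, Rinv_l by lra. assert (0 <= c * (1 - m)) by (apply Rmult_le_pos; lra). lra.
Qed.

Lemma push_ends c : 0 < c -> push c 0 = 0 /\ push c 1 = 0.
Proof. intros Hc. unfold push. split; field; lra. Qed.

Lemma push_one m : push 1 m = 0.
Proof. unfold push. replace (m + 1 * (1 - m)) with 1 by ring. field. Qed.

Lemma push_cancel c t : 0 < c ->
  push (/ c) (clamp (t + push c (clamp t))) = - push c (clamp t).
Proof.
  intros Hc. assert (Hc' := Rinv_0_lt_compat c Hc).
  destruct (push_ends Hc) as [E0 E1]. destruct (push_ends Hc') as [E0' E1'].
  destruct (clamp_cases t) as [[H1 H2]|[[H1 H2]|[H1 H2]]]; rewrite H2.
  - rewrite E0, Rplus_0_r, H2, E0'. ring.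
  - assert (Hb := push_bounds Hc H1).
    assert (Hcl : clamp (t + push c t) = t + push c t).
    { destruct (clamp_cases (t + push c t)) as [[? ?]|[[? ?]|[? ?]]]; lra. }
    rewrite Hcl. assert (Hden := push_denominator Hc H1).
    assert (Hden' := push_denominator Hc' Hb).
    unfold push at 1. unfold push in Hden' at 1 2 |- *.
    replace (t + (t / (t + c * (1 - t)) - t)) with (t / (t + c * (1 - t))) in * by ring.
    (* The denominator of the inverse map at the image point is the reciprocal of the original
       denominator. *)
    replace (t / (t + c * (1 - t)) + / c * (1 - t / (t + c * (1 - t)))) with (/ (t + c * (1 - t)))
      by (field; lra).
    field. lra.
  - rewrite E1, Rplus_0_r, H2, E1'. ring.
Qed.

Fixpoint fsum (m : nat) : (Fin.t m -> R) -> R :=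
  match m with
  | 0%nat => fun _ => 0
  | S m => fun f => f Fin.F1 + fsum (fun i => f (Fin.FS i))
  end.

Lemma fsum_nonneg m (f : Fin.t m -> R) : (forall i, 0 <= f i) -> 0 <= fsum f.
Proof.
  induction m as [|m IH]; intros H; simpl; [lra|].
  assert (H1 := H Fin.F1). assert (H2 := IH (fun i => f (Fin.FS i)) (fun i => H _)). lra.
Qed.

Lemma fsum_ge m (f : Fin.t m -> R) i : (forall i, 0 <= f i) -> f i <= fsum f.
Proof.
  induction i as [m|m i IH]; intros H; simpl.
  - assert (H2 := @fsum_nonneg _ (fun i => f (Fin.FS i)) (fun i => H _)). lra.
  - assert (H1 := H Fin.F1). assert (H2 := IH (fun i => f (Fin.FS i)) (fun i => H _)). lra.
Qed.

Section Box.
Variables (m : nat) (v : Rn (S m)) (eta : R).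
Hypothesis eta_pos : 0 < eta.

(** A tent function of all coordinates but the first: [1] on the axis through [v], [0] once one of
    them is [eta] away. It fades the shear out sideways. *)
Definition weight (w : Rn (S m)) : R :=
  clamp (1 - fsum (fun i => Rabs ((w (Fin.FS i) - v (Fin.FS i)) * / eta))).

Definition height (w : Rn (S m)) : R := (w Fin.F1 - v Fin.F1) * / eta.

(* The first coordinate is moved by a Moebius map of the unit interval; replacing
   the parameter c by its inverse inverts the map. *)
Definition shear (c : R -> R -> R) (s : R) (w : Rn (S m)) : Rn (S m) :=
  fun i => Fin.caseS' i (fun _ => R) (w Fin.F1 + eta * push (c s (weight w)) (clamp (height w)))
             (fun i => w (Fin.FS i)).

Definition box (w : Rn (S m)) : Prop := forall i, Rabs (w i - v i) <= eta.

Definition admissible (c : R -> R -> R) : Prop :=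
  (forall s l, 0 <= s <= 1 -> 0 <= l <= 1 -> 0 < c s l) /\ (forall s, 0 <= s <= 1 -> c s 0 = 1).

Lemma weight_bounds w : 0 <= weight w <= 1.
Proof. unfold weight. destruct (clamp_cases (1 - fsum (fun i => Rabs ((w (Fin.FS i) - v (Fin.FS i)) * / eta)))) as [[? ->]|[[? ->]|[? ->]]]; lra. Qed.

Lemma weight_shear c s w : weight (shear c s w) = weight w.
Proof. reflexivity. Qed.

Lemma height_shear c s w :
  height (shear c s w) = height w + push (c s (weight w)) (clamp (height w)).
Proof.
  unfold height at 1.
  change (shear c s w Fin.F1) with (w Fin.F1 + eta * push (c s (weight w)) (clamp (height w))).
  generalize (push (c s (weight w)) (clamp (height w))). intros q. unfold height. field. lra.
Qed.

(** The weight depends only on coordinates that the shear leaves alone, so both shears use the same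
    weight and [push_cancel] applies on each line. *)
Lemma shear_cancel c c' s w : admissible c -> 0 <= s <= 1 ->
  (forall l, 0 <= l <= 1 -> c' s l = / c s l) -> shear c' s (shear c s w) = w.
Proof.
  intros [Hc _] Hs Hcc. assert (Hw := weight_bounds w).
  apply functional_extensionality. intros i. apply (Fin.caseS' i).
  - unfold shear at 1. simpl Fin.caseS'. rewrite weight_shear, height_shear, Hcc by auto.
    rewrite push_cancel by auto. unfold shear. simpl. ring.
  - reflexivity.
Qed.

(** Outside the box either the height clamps to an end of the unit interval, where the displacement
    is [0], or a lateral coordinate makes the weight [0] and the parameter [1]. *)
Lemma shear_off c s w : admissible c -> 0 <= s <= 1 -> ~ box w -> shear c s w = w.
Proof.
  intros [Hc Hc0] Hs Hw.
  assert (Hp : push (c s (weight w)) (clamp (height w)) = 0).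
  { apply not_all_ex_not in Hw. destruct Hw as [i Hi]. apply Rnot_le_lt in Hi.
    assert (Hi' : 1 < Rabs ((w i - v i) * / eta)).
    { rewrite Rabs_mult, (Rabs_right (/ eta)).
      - apply Rmult_lt_reg_r with eta; [auto|]. rewrite Rmult_assoc, Rinv_l; lra.
      - left. now apply Rinv_0_lt_compat. }
    revert i Hi Hi'. intros i. apply (Fin.caseS' i).
    - intros _ Hi. fold (height w) in Hi. destruct (@push_ends (c s (weight w))) as [E0 E1].
      { apply Hc; [auto|apply weight_bounds]. }
      destruct (clamp_cases (height w)) as [[H1 ->]|[[H1 H2]|[H1 ->]]]; [auto| |auto].
      rewrite Rabs_right in Hi; lra.
    - intros j _ Hj. replace (weight w) with 0; [rewrite Hc0 by auto; apply push_one|].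
      unfold weight. 
      assert (Hf := @fsum_ge m (fun i => Rabs ((w (Fin.FS i) - v (Fin.FS i)) * / eta)) j (fun i => Rabs_pos _)).
      destruct (clamp_cases (1 - fsum (fun i => Rabs ((w (Fin.FS i) - v (Fin.FS i)) * / eta)))) as [[? ->]|[[? ?]|[? ?]]]; [auto|simpl in Hf; lra|simpl in Hf; lra]. }
  apply functional_extensionality. intros i. apply (Fin.caseS' i).
  - unfold shear. simpl. rewrite Hp. ring.
  - reflexivity.
Qed.

Lemma shear_box c s w : admissible c -> 0 <= s <= 1 -> box w -> box (shear c s w).
Proof.
  intros [Hc _] Hs Hw i. revert i.
  assert (H1 : forall i : Fin.t (S m), i = Fin.F1 \/ exists j, i = Fin.FS j).
  { intros i. apply (Fin.caseS' i); [auto|]. intros j. right. now exists j. }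
  intros i. destruct (H1 i) as [->|[j ->]]; [|apply (Hw (Fin.FS j))].
  assert (Hh : shear c s w Fin.F1 - v Fin.F1 = eta * height (shear c s w)).
  { unfold height. field. lra. }
  rewrite Hh, height_shear, Rabs_mult, (Rabs_right eta) by lra.
  rewrite <- (Rmult_1_r eta) at 2. apply Rmult_le_compat_l; [lra|].
  assert (Hp : 0 < c s (weight w)) by (apply Hc; [auto|apply weight_bounds]).
  destruct (push_ends Hp) as [E0 E1].
  assert (Hb : -1 <= height w <= 1).
  { assert (Ha : Rabs (height w) <= 1).
    { unfold height. rewrite Rabs_mult, (Rabs_right (/ eta)).
      - apply Rmult_le_reg_r with eta; [auto|]. rewrite Rmult_assoc, Rinv_l; [|lra].
        specialize (Hw Fin.F1). lra.
      - left. now apply Rinv_0_lt_compat. }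
    assert (H2 := Rle_abs (height w)). assert (H3 := Rle_abs (- height w)).
    rewrite Rabs_Ropp in H3. lra. }
  apply Rabs_le.
  destruct (clamp_cases (height w)) as [[H2 ->]|[[H2 ->]|[H2 ->]]]; try lra.
  assert (H3 := push_bounds Hp H2). lra.
Qed.

Definition euclid_joint (phi : R -> Rn (S m) -> R) (s0 : R) (w0 : Rn (S m)) : Prop :=
  forall eps, 0 < eps -> exists delta, 0 < delta /\ forall s w, Rabs (s - s0) < delta ->
    (forall i, Rabs (w i - w0 i) < delta) -> Rabs (phi s w - phi s0 w0) < eps.

Lemma joint_const a s0 w0 : euclid_joint (fun _ _ => a) s0 w0.
Proof. intros eps He. exists 1. split; [lra|]. intros. now rewrite Rminus_diag, Rabs_R0. Qed.

Lemma joint_param s0 w0 : euclid_joint (fun s _ => s) s0 w0.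
Proof. intros eps He. exists eps. auto. Qed.

Lemma joint_coord i s0 w0 : euclid_joint (fun _ w => w i) s0 w0.
Proof. intros eps He. exists eps. auto. Qed.

Lemma joint_plus f g s0 w0 : euclid_joint f s0 w0 -> euclid_joint g s0 w0 ->
  euclid_joint (fun s w => f s w + g s w) s0 w0.
Proof.
  intros Hf Hg eps He. destruct (Hf (eps / 2)) as [d [Hd Hd']]; [lra|].
  destruct (Hg (eps / 2)) as [d' [Hd1 Hd1']]; [lra|].
  assert (R1 := Rmin_l d d'). assert (R2 := Rmin_r d d').
  exists (Rmin d d'). split; [now apply Rmin_pos|]. intros s w Hs Hw.
  assert (H1 : Rabs (f s w - f s0 w0) < eps / 2).
  { apply Hd'; [lra|]. intros i. specialize (Hw i). lra. }
  assert (H2 : Rabs (g s w - g s0 w0) < eps / 2).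
  { apply Hd1'; [lra|]. intros i. specialize (Hw i). lra. }
  apply Rabs_def2 in H1. apply Rabs_def2 in H2. apply Rabs_def1; lra.
Qed.

Lemma joint_comp g f s0 w0 : euclid_joint f s0 w0 -> continuity_pt g (f s0 w0) ->
  euclid_joint (fun s w => g (f s w)) s0 w0.
Proof.
  intros Hf Hg eps He. destruct (Hg eps He) as [a [Ha Hga]].
  destruct (Hf a Ha) as [d [Hd Hd']]. exists d. split; [auto|]. intros s w Hs Hw.
  specialize (Hd' s w Hs Hw).
  (* [continuity_pt] speaks only of points different from the base point, hence the case of
     equality. *)
  destruct (Req_dec (f s w) (f s0 w0)) as [->|Hne].
  - now rewrite Rminus_diag, Rabs_R0.
  - apply (Hga (f s w)). split; [|exact Hd']. split; [exact I|]. auto.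
Qed.

Lemma joint_opp f s0 w0 : euclid_joint f s0 w0 -> euclid_joint (fun s w => - f s w) s0 w0.
Proof.
  intros Hf. apply (joint_comp (g := Ropp)); [auto|].
  apply continuity_pt_opp, derivable_continuous_pt, derivable_pt_id.
Qed.

(** Polarisation, [f g = ((f + g)^2 - (f - g)^2) / 4], reduces products to sums and the one-variable
    function [Rsqr]. *)
Lemma joint_mult f g s0 w0 : euclid_joint f s0 w0 -> euclid_joint g s0 w0 ->
  euclid_joint (fun s w => f s w * g s w) s0 w0.
Proof.
  intros Hf Hg.
  assert (Hsq : forall h, euclid_joint h s0 w0 -> euclid_joint (fun s w => Rsqr (h s w) / 4) s0 w0).
  { intros h Hh. apply (joint_comp (g := fun x => Rsqr x / 4)); [auto|].
    apply derivable_continuous_pt. unfold Rdiv. apply derivable_pt_mult; [apply derivable_pt_Rsqr|apply derivable_pt_const]. }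
  assert (Heq : (fun s w => f s w * g s w) =
    (fun s w => Rsqr (f s w + g s w) / 4 + - (Rsqr (f s w + - g s w) / 4))).
  { apply functional_extensionality; intros s. apply functional_extensionality; intros w.
    unfold Rsqr. field. }
  rewrite Heq. apply joint_plus; [|apply joint_opp]; apply Hsq; apply joint_plus; auto.
  now apply joint_opp.
Qed.

Lemma joint_inv f s0 w0 : euclid_joint f s0 w0 -> f s0 w0 <> 0 ->
  euclid_joint (fun s w => / f s w) s0 w0.
Proof.
  intros Hf Hn. apply (joint_comp (g := Rinv)); [auto|].
  apply (@continuity_pt_inv (fun x => x)); [|auto].
  apply derivable_continuous_pt, derivable_pt_id.
Qed.

Lemma joint_abs f s0 w0 : euclid_joint f s0 w0 -> euclid_joint (fun s w => Rabs (f s w)) s0 w0.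
Proof. intros Hf. apply (joint_comp (g := Rabs)); [auto|]. apply Rcontinuity_abs. Qed.

Lemma joint_clamp f s0 w0 : euclid_joint f s0 w0 -> euclid_joint (fun s w => clamp (f s w)) s0 w0.
Proof.
  intros Hf. unfold clamp. unfold Rdiv, Rminus.
  apply joint_mult; [|apply joint_const].
  apply joint_plus; [apply joint_plus; [apply joint_const|now apply joint_abs]|].
  apply joint_opp, joint_abs, joint_plus; [auto|apply joint_const].
Qed.

Lemma joint_fsum k (f : R -> Rn (S m) -> Fin.t k -> R) s0 w0 :
  (forall i, euclid_joint (fun s w => f s w i) s0 w0) ->
  euclid_joint (fun s w => fsum (f s w)) s0 w0.
Proof.
  revert f. induction k as [|k IH]; intros f Hf; simpl; [apply joint_const|].
  apply joint_plus; [apply Hf|]. apply (IH (fun s w i => f s w (Fin.FS i))). intros i. apply Hf.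
Qed.

Lemma joint_weight s0 w0 : euclid_joint (fun _ w => weight w) s0 w0.
Proof.
  apply (joint_clamp (f := fun _ w => 1 - fsum (fun i => Rabs ((w (Fin.FS i) - v (Fin.FS i)) * / eta)))).
  apply joint_plus; [apply joint_const|]. apply joint_opp.
  apply (@joint_fsum m (fun _ w i => Rabs ((w (Fin.FS i) - v (Fin.FS i)) * / eta))). intros i.
  apply joint_abs, joint_mult; [|apply joint_const].
  apply joint_plus; [apply joint_coord|apply joint_const].
Qed.

Lemma joint_height s0 w0 : euclid_joint (fun _ w => height w) s0 w0.
Proof.
  apply joint_mult; [|apply joint_const].
  apply joint_plus; [apply joint_coord|apply joint_const].
Qed.

Lemma joint_shear c s0 w0 i : admissible c -> 0 <= s0 <= 1 ->
  euclid_joint (fun s w => c s (weight w)) s0 w0 ->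
  euclid_joint (fun s w => shear c s w i) s0 w0.
Proof.
  intros [Hc _] Hs Hj. apply (Fin.caseS' i).
  - unfold shear. simpl. unfold push.
    assert (Hcl := joint_clamp (joint_height s0 w0)). simpl in Hcl.
    apply joint_plus; [apply joint_coord|].
    apply joint_mult; [apply joint_const|]. apply joint_plus; [|now apply joint_opp].
    apply joint_mult; [auto|]. apply joint_inv.
    + apply joint_plus; [auto|]. apply joint_mult; [auto|].
      apply joint_plus; [apply joint_const|now apply joint_opp].
    + apply Rgt_not_eq. apply push_denominator.
      * apply Hc; [auto|apply weight_bounds].
      * destruct (clamp_cases (height w0)) as [[? ->]|[[? ->]|[? ->]]]; lra.
  - intros j. apply joint_coord.
Qed.

End Box.

(** * Charts *)

(** Total maps with meaningless values off [U] and [V] replace a homeomorphism of subset types,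
    which keeps membership proofs out of the formulas. *)
Definition chart (X : Type) (tX : opens X) (n : nat) (U : X -> Prop) (V : Rn n -> Prop)
  (hx : X -> Rn n) (hi : Rn n -> X) : Prop :=
  tX U /\ euclid_top n V /\
  (forall y, U y -> V (hx y) /\ hi (hx y) = y) /\
  (forall w, V w -> U (hi w) /\ hx (hi w) = w) /\
  (forall W, euclid_top n W -> tX (fun y => U y /\ W (hx y))) /\
  (forall O, tX O -> euclid_top n (fun w => V w /\ O (hi w))).

Lemma euclid_inter n U V : euclid_top n U -> euclid_top n V -> euclid_top n (fun w => U w /\ V w).
Proof.
  intros HU HV x [H1 H2]. destruct (HU x H1) as [a [Ha Ha']].
  destruct (HV x H2) as [b [Hb Hb']]. exists (Rmin a b). split; [now apply Rmin_pos|].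
  intros y Hy. assert (H3 := Rmin_l a b). assert (H4 := Rmin_r a b).
  split; [apply Ha'|apply Hb']; intros i; specialize (Hy i); lra.
Qed.

Lemma joint_uniform m k (f : Fin.t k -> R -> Rn (S m) -> R) s0 w0 eps :
  (forall i, euclid_joint (f i) s0 w0) -> 0 < eps ->
  exists delta, 0 < delta /\ forall s w, Rabs (s - s0) < delta ->
    (forall i, Rabs (w i - w0 i) < delta) -> forall i, Rabs (f i s w - f i s0 w0) < eps.
Proof.
  intros Hf He. revert f Hf. induction k as [|k IH]; intros f Hf.
  - exists 1. split; [lra|]. intros s w _ _ i. apply (Fin.case0 (fun _ => _) i).
  - destruct (IH (fun i => f (Fin.FS i)) (fun i => Hf _)) as [d [Hd Hd']].
    destruct (Hf Fin.F1 eps He) as [d' [Hd1 Hd1']].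
    assert (R1 := Rmin_l d d'). assert (R2 := Rmin_r d d').
    exists (Rmin d d'). split; [now apply Rmin_pos|]. intros s w Hs Hw i.
    apply (Fin.caseS' i).
    + apply Hd1'; [lra|]. intros j. specialize (Hw j). lra.
    + apply Hd'; [lra|]. intros j. specialize (Hw j). lra.
Qed.

Lemma euclid_ball_open n (v : Rn n) delta : euclid_top n (fun w => forall i, Rabs (w i - v i) < delta).
Proof.
  assert (Hgen : forall k (g : Fin.t k -> R), (forall i, Rabs (g i) < delta) ->
    exists r, 0 < r /\ forall g' : Fin.t k -> R, (forall i, Rabs (g i - g' i) < r) ->
      forall i, Rabs (g' i) < delta).
  { induction k as [|k IH]; intros g Hg.
    - exists 1. split; [lra|]. intros g' _ i. apply (Fin.case0 (fun _ => _) i).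
    - destruct (IH (fun i => g (Fin.FS i)) (fun i => Hg _)) as [r [Hr Hr']].
      assert (Hg1 := Hg Fin.F1).
      set (r1 := delta - Rabs (g Fin.F1)).
      assert (Hr1 : 0 < r1) by (unfold r1; lra).
      assert (R1 := Rmin_l r r1). assert (R2 := Rmin_r r r1).
      exists (Rmin r r1). split; [now apply Rmin_pos|]. intros g' Hg' i.
      apply (Fin.caseS' i).
      + specialize (Hg' Fin.F1). assert (Ht := Rabs_triang (g Fin.F1) (- (g Fin.F1 - g' Fin.F1))).
        rewrite Rabs_Ropp in Ht.
        replace (g Fin.F1 + - (g Fin.F1 - g' Fin.F1)) with (g' Fin.F1) in Ht by ring.
        unfold r1 in *. lra.
      + apply (Hr' (fun i => g' (Fin.FS i))). intros j. specialize (Hg' (Fin.FS j)). lra. }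
  intros w Hw. destruct (Hgen _ (fun i => w i - v i) Hw) as [r [Hr Hr']].
  exists r. split; [auto|]. intros w' Hw'. apply (Hr' (fun i => w' i - v i)).
  intros i. specialize (Hw' i). now replace (w i - v i - (w' i - v i)) with (w i - w' i) by ring.
Qed.

Lemma chart_exists (X : Type) (tX : opens X) n x :
  is_topology tX -> locally_euclidean tX n -> exists U V hx hi, @chart X tX n U V hx hi /\ U x.
Proof.
  intros HtX Hle. destruct (Hle x) as [U [HU [HUx [V [HV [h [Hh [g [Hg [Hgh Hhg]]]]]]]]]].
  set (hx := fun y => match excluded_middle_informative (U y) with
    | left p => proj1_sig (h (exist _ y p)) | right _ => fun _ => 0 end).
  set (hi := fun w => match excluded_middle_informative (V w) with
    | left p => proj1_sig (g (exist _ w p)) | right _ => x end).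
  assert (Hhx : forall y (p : U y), hx y = proj1_sig (h (exist _ y p))).
  { intros y p. unfold hx. destruct (excluded_middle_informative (U y)) as [q|]; [|tauto].
    now rewrite (proof_irrelevance _ p q). }
  assert (Hhi : forall w (p : V w), hi w = proj1_sig (g (exist _ w p))).
  { intros y p. unfold hi. destruct (excluded_middle_informative (V y)) as [q|]; [|tauto].
    now rewrite (proof_irrelevance _ p q). }
  exists U, V, hx, hi. split; [|auto]. split; [auto|]. split; [auto|].
  split; [|split; [|split]].
  - intros y p. rewrite (Hhx y p). assert (q := proj2_sig (h (exist _ y p))). split; [exact q|].
    rewrite (Hhi _ q). replace (exist _ _ q) with (h (exist _ y p)).
    + now rewrite Hgh.
    + destruct (h (exist _ y p)) as [z Hz]. simpl. f_equal. apply proof_irrelevance.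
  - intros w p. rewrite (Hhi w p). assert (q := proj2_sig (g (exist _ w p))). split; [exact q|].
    rewrite (Hhx _ q). replace (exist _ _ q) with (g (exist _ w p)).
    + now rewrite Hhg.
    + destruct (g (exist _ w p)) as [z Hz]. simpl. f_equal. apply proof_irrelevance.
  - intros W HW. destruct (Hh (fun z => W (proj1_sig z))) as [O [HO HOW]].
    { exists W. split; [auto|tauto]. }
    apply (@open_ext _ _ (fun y => U y /\ O y)); [now apply open_inter|].
    intros y. split; intros [p Hy]; (split; [exact p|]).
    + rewrite (Hhx y p). now apply (HOW (exist _ y p)).
    + rewrite (Hhx y p) in Hy. now apply (HOW (exist _ y p)).
  - intros O HO. destruct (Hg (fun z => O (proj1_sig z))) as [W [HW HOW]].
    { exists O. split; [auto|tauto]. }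
    apply (@open_ext _ _ (fun y => V y /\ W y)); [now apply euclid_inter|].
    intros y. split; intros [p Hy]; (split; [exact p|]).
    + rewrite (Hhi y p). now apply (HOW (exist _ y p)).
    + rewrite (Hhi y p) in Hy. now apply (HOW (exist _ y p)).
Qed.

Section Transport.
Variables (X : Type) (tX : opens X) (m : nat).
Hypothesis HtX : is_topology tX.
Variables (U : X -> Prop) (V : Rn (S m) -> Prop) (hx : X -> Rn (S m)) (hi : Rn (S m) -> X).
Hypothesis Hchart : chart tX U V hx hi.
Variables (v : Rn (S m)) (eta : R).
Hypothesis eta_pos : 0 < eta.
Hypothesis box_in : forall w, box v eta w -> V w.

Definition chart_box (y : X) : Prop := U y /\ box v eta (hx y).
Hypothesis chart_box_closed : closed tX chart_box.

Let hU : tX U := proj1 Hchart.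
Let hxi := proj1 (proj2 (proj2 Hchart)).
Let hix := proj1 (proj2 (proj2 (proj2 Hchart))).
Let hx_cont := proj1 (proj2 (proj2 (proj2 (proj2 Hchart)))).
Let hi_cont := proj2 (proj2 (proj2 (proj2 (proj2 Hchart)))).

Definition transport (c : R -> R -> R) (s : R) (y : X) : X :=
  if excluded_middle_informative (U y) then hi (shear v eta c s (hx y)) else y.

Lemma transport_in c s y : U y -> transport c s y = hi (shear v eta c s (hx y)).
Proof. intros Hy. unfold transport. destruct (excluded_middle_informative _); tauto. Qed.

Lemma shear_in c s w : admissible c -> 0 <= s <= 1 -> V w -> V (shear v eta c s w).
Proof.
  intros Hc Hs Hw. destruct (classic (box v eta w)) as [Hb|Hb].
  - apply box_in. now apply shear_box.
  - now rewrite shear_off.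
Qed.

Lemma transport_off c s y : admissible c -> 0 <= s <= 1 -> ~ chart_box y -> transport c s y = y.
Proof.
  intros Hc Hs Hy. unfold transport. destruct (excluded_middle_informative (U y)) as [Hu|]; [|auto].
  rewrite shear_off; auto; [now apply hxi|]. intros Hb. apply Hy. now split.
Qed.

Lemma transport_cancel c c' s y : admissible c -> 0 <= s <= 1 ->
  (forall l, 0 <= l <= 1 -> c' s l = / c s l) -> transport c' s (transport c s y) = y.
Proof.
  intros Hc Hs Hcc. destruct (classic (U y)) as [Hy|Hy].
  - rewrite (transport_in c s Hy).
    assert (Hv : V (shear v eta c s (hx y))) by (apply shear_in; auto; now apply hxi).
    rewrite transport_in by now apply hix.
    rewrite (proj2 (hix Hv)), shear_cancel by auto. now apply hxi.
  - unfold transport. destruct (excluded_middle_informative (U y)); [tauto|].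
    destruct (excluded_middle_informative (U y)); tauto.
Qed.

(** On [U] continuity comes from the shear in coordinates. At a point off [U] it rests on
    [chart_box] being closed in all of [X]: a whole neighbourhood is then left fixed. *)
Lemma transport_continuous c : admissible c ->
  (forall s w, 0 <= s <= 1 -> euclid_joint (fun s w => c s (weight v eta w)) s w) ->
  jointly_continuous tX (transport c).
Proof.
  intros Hc Hj s x O Hs HO HOx. destruct (classic (U x)) as [Hx|Hx].
  - rewrite (transport_in c s Hx) in HOx.
    assert (Hv : V (shear v eta c s (hx x))) by (apply shear_in; auto; now apply hxi).
    destruct (hi_cont HO (conj Hv HOx)) as [eps [He Heps]].
    assert (Hd : exists delta, 0 < delta /\ forall s' w, Rabs (s' - s) < delta ->
      (forall i, Rabs (w i - hx x i) < delta) ->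
      forall i, Rabs (shear v eta c s' w i - shear v eta c s (hx x) i) < eps).
    { assert (H : forall i, euclid_joint (fun s w => shear v eta c s w i) s (hx x)).
      { intros i. apply joint_shear; auto. }
      exact (joint_uniform (f := fun i s w => shear v eta c s w i) H He). }
    destruct Hd as [delta [Hd Hdelta]].
    exists delta, (fun y => U y /\ forall i, Rabs (hx y i - hx x i) < delta).
    split; [auto|]. split; [|split].
    + apply (hx_cont (W := fun w => forall i, Rabs (w i - hx x i) < delta)). apply euclid_ball_open.
    + split; [auto|]. intros i. now rewrite Rminus_diag, Rabs_R0.
    + intros s' y Hs' Hss [Hy1 Hy2]. rewrite (transport_in c s' Hy1).
      apply (Heps (shear v eta c s' (hx y))). intros i. rewrite Rabs_minus_sym. now apply Hdelta.
  - assert (Hb : ~ chart_box x) by (intros [? _]; auto).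
    rewrite (transport_off Hc Hs Hb) in HOx.
    exists 1, (fun y => O y /\ ~ chart_box y). split; [lra|]. split; [now apply open_diff|].
    split; [auto|]. intros s' y Hs' _ [Hy1 Hy2]. now rewrite transport_off.
Qed.

Lemma chart_halfspace_closed (P : R -> Prop) :
  (forall r, ~ P r -> exists eps, 0 < eps /\ forall r', Rabs (r - r') < eps -> ~ P r') ->
  closed tX (fun y => chart_box y /\ P (hx y Fin.F1)).
Proof.
  intros HP. apply (open_locally HtX). intros y Hy.
  destruct (classic (chart_box y)) as [Hb|Hb].
  - exists (fun y => U y /\ ~ P (hx y Fin.F1)). split; [|split].
    + apply (hx_cont (W := fun w => ~ P (w Fin.F1))). intros w Hw.
      destruct (HP _ Hw) as [eps [He He']]. exists eps. split; [auto|].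
      intros w' Hw'. apply He', Hw'.
    + split; [apply Hb|]. tauto.
    + intros z [_ Hz] [_ Hz']. auto.
  - exists (fun y => ~ chart_box y). split; [exact chart_box_closed|]. split; [auto|]. tauto.
Qed.

Definition speed (s l : R) : R := 1 + s * l.

Lemma speed_pos s l : 0 <= s <= 1 -> 0 <= l <= 1 -> 0 < speed s l.
Proof. intros. unfold speed. assert (0 <= s * l) by (apply Rmult_le_pos; lra). lra. Qed.

Lemma speed_admissible : admissible speed.
Proof.
  split; [apply speed_pos|]. intros. unfold speed. ring.
Qed.

Lemma speed_inv_admissible : admissible (fun s l => / speed s l).
Proof.
  split.
  - intros. apply Rinv_0_lt_compat. now apply speed_pos.
  - intros. unfold speed. rewrite Rmult_0_r, Rplus_0_r. apply Rinv_1.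
Qed.

Lemma fsum_zero k (f : Fin.t k -> R) : (forall i, f i = 0) -> fsum f = 0.
Proof.
  induction k as [|k IH]; intros H; simpl; [auto|]. rewrite H, (IH (fun i => f (Fin.FS i))); [lra|auto].
Qed.

(** The point of height [/ 2] on the axis of the box, where the weight is [1]; its motion under
    [speed] is explicit and monotone in time. *)
Definition probe : Rn (S m) :=
  fun i => Fin.caseS' i (fun _ => R) (v Fin.F1 + eta / 2) (fun i => v (Fin.FS i)).

Lemma probe_box : box v eta probe.
Proof.
  intros i. apply (Fin.caseS' i); [|intros j]; unfold probe; simpl; apply Rabs_le; lra.
Qed.

Lemma shear_probe s : 0 <= s <= 1 -> shear v eta speed s probe Fin.F1 = v Fin.F1 + eta / (2 + s).
Proof.
  intros Hs.
  assert (Hw : weight v eta probe = 1).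
  { unfold weight. rewrite fsum_zero.
    - destruct (clamp_cases (1 - 0)) as [[? ?]|[[? ->]|[? ->]]]; lra.
    - intros i. unfold probe. simpl. now rewrite Rminus_diag, Rmult_0_l, Rabs_R0. }
  assert (Hh : height v eta probe = / 2).
  { unfold height, probe. simpl. field. lra. }
  assert (Hc : clamp (/ 2) = / 2).
  { destruct (clamp_cases (/ 2)) as [[? ?]|[[? ->]|[? ?]]]; lra. }
  unfold shear. simpl. rewrite Hw, Hh, Hc. unfold push, speed. field. lra.
Qed.

Lemma chart_box_large k : compact_set tX chart_box ->
  large tX chart_box k (fun r => exists s, 0 <= s <= 1 /\
    r = (transport speed s, transport (fun s l => / speed s l) s)).
Proof.
  intros Hcomp.
  assert (HVp : V probe) by (apply box_in, probe_box).
  assert (Hjs : forall s w, 0 <= s <= 1 -> euclid_joint (fun s w => speed s (weight v eta w)) s w).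
  { intros s w Hs. apply joint_plus; [apply joint_const|].
    apply joint_mult; [apply joint_param|apply joint_weight]. }
  apply (@isotopy_large X tX _ _ chart_box (hi probe)); auto.
  - apply transport_continuous; [apply speed_admissible|auto].
  - apply transport_continuous; [apply speed_inv_admissible|]. intros s w Hs.
    apply (joint_inv (f := fun s w => speed s (weight v eta w))); [auto|].
    apply Rgt_not_eq, speed_pos; [auto|apply weight_bounds].
  - intros s x Hs. apply transport_cancel; [apply speed_admissible|auto|auto].
  - intros s x Hs. apply transport_cancel; [apply speed_inv_admissible|auto|].
    intros l Hl. now rewrite Rinv_inv.
  - intros s x Hs. apply transport_off; [apply speed_admissible|auto].
  - split; [now apply hix|]. rewrite (proj2 (hix HVp)). apply probe_box.
  - intros a b Ha Hab Hb.
    assert (Hin : forall s, 0 <= s <= 1 -> chart_box (transport speed s (hi probe)) /\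
      hx (transport speed s (hi probe)) Fin.F1 = v Fin.F1 + eta / (2 + s)).
    { intros s Hs. rewrite transport_in by now apply hix. rewrite (proj2 (hix HVp)).
      assert (Hbs : box v eta (shear v eta speed s probe)).
      { apply shear_box; [auto|apply speed_admissible|auto|apply probe_box]. }
      assert (Hv := hix (box_in Hbs)). split; [split; [apply Hv|]|]; rewrite (proj2 Hv); [auto|].
      now apply shear_probe. }
    assert (Hmon : forall s t, 0 <= s -> s <= t -> eta / (2 + t) <= eta / (2 + s)).
    { intros s t Hs Hst. unfold Rdiv. apply Rmult_le_compat_l; [lra|].
      apply Rinv_le_contravar; lra. }
    (* By [shear_probe] the probe moves down as time passes, so the parts of the box above its
       position at time [a] and below its position at time [b] are disjoint. *)
    exists (fun y => chart_box y /\ v Fin.F1 + eta / (2 + a) <= hx y Fin.F1),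
      (fun y => chart_box y /\ hx y Fin.F1 <= v Fin.F1 + eta / (2 + b)).
    split; [|split; [|split; [|split; [|split; [|split]]]]].
    + apply (chart_halfspace_closed (P := fun r => v Fin.F1 + eta / (2 + a) <= r)).
      intros r Hr. exists (v Fin.F1 + eta / (2 + a) - r). split; [lra|]. intros r' Hr'.
      apply Rabs_def2 in Hr'. lra.
    + apply (chart_halfspace_closed (P := fun r => r <= v Fin.F1 + eta / (2 + b))).
      intros r Hr. exists (r - (v Fin.F1 + eta / (2 + b))). split; [lra|]. intros r' Hr'.
      apply Rabs_def2 in Hr'. lra.
    + tauto.
    + tauto.
    + intros y [[_ H1] [_ H2]].
      assert (eta / (2 + b) < eta / (2 + a)); [|lra].
      unfold Rdiv. apply Rmult_lt_compat_l; [lra|]. apply Rinv_lt_contravar; [|lra].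
      apply Rmult_lt_0_compat; lra.
    + intros s Hs. assert (Hs1 : 0 <= s <= 1) by lra. destruct (Hin s Hs1) as [H1 H2]. split; [auto|].
      assert (H3 := Hmon s a). lra.
    + intros s Hs. assert (Hs1 : 0 <= s <= 1) by lra. destruct (Hin s Hs1) as [H1 H2]. split; [auto|].
      assert (H3 := Hmon b s). lra.
  - lra.
  - lra.
  - lra.
Qed.

End Transport.

(** The box is compact as a closed subset of the compact neighbourhood [C1]. It is closed in [X],
    and not only in the chart domain, because it lies in the closed ball of radius [eps / 2], which
    is contained in that domain and avoids [C]. *)
Lemma manifold_gadget (X : Type) (tX : opens X) (d : X -> X -> R) (m : nat) :
  is_metric_for tX d -> locally_compact tX -> locally_euclidean tX (S m) -> ~ compact_space tX ->
  forall k C, compact_set tX C -> exists B S,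
    compact_set tX B /\ (forall x, B x -> ~ C x) /\ large tX B k S.
Proof.
  intros Hd Hlc Hle Hnc k C HC. assert (HtX := metric_topology Hd).
  destruct (noncompact_escapes Hnc HC) as [x Hx].
  destruct (chart_exists x HtX Hle) as [U [V [hx [hi [Hch HUx]]]]].
  destruct (Hlc x) as [O1 [C1 [HO1 [HO1x [HOC1 HC1]]]]]. apply compact_subspace in HC1.
  destruct Hch as [HU [HV [hxi [hix [hxc hic]]]]] eqn:Hch'.
  assert (HN : tX (fun y => (U y /\ O1 y) /\ ~ C y)).
  { apply open_diff; [auto|now apply open_inter|]. now apply (compact_closed HtX (metric_hausdorff Hd)). }
  destruct (proj1 (proj2 (proj2 (proj2 (proj2 Hd))) _) HN x (conj (conj HUx HO1x) Hx)) as [eps [He HeN]].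
  assert (HD : forall y, d x y <= eps / 2 -> (U y /\ O1 y) /\ ~ C y) by (intros y Hy; apply HeN; lra).
  assert (Hv0 : V (hx x) /\ d x (hi (hx x)) < eps / 2).
  { split; [now apply hxi|]. rewrite (proj2 (hxi x HUx)), (metric_refl Hd). lra. }
  destruct (hic _ (ball_open Hd x (eps / 2)) (hx x) Hv0) as [eta0 [Heta Hball]].
  (* Halving puts the closed box of radius [eta] into the open one of radius [eta0]. *)
  set (eta := eta0 / 2). assert (eta_pos : 0 < eta) by (unfold eta; lra).
  assert (Hbox : forall w, box (hx x) eta w -> V w /\ d x (hi w) < eps / 2).
  { intros w Hw. apply Hball. intros i. specialize (Hw i). rewrite Rabs_minus_sym. unfold eta in Hw. lra. }
  assert (HBD : forall y, chart_box U hx (hx x) eta y -> d x y <= eps / 2).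
  { intros y [Hy1 Hy2]. destruct (Hbox _ Hy2) as [_ H]. rewrite (proj2 (hxi y Hy1)) in H. lra. }
  assert (Hclosed : closed tX (chart_box U hx (hx x) eta)).
  { apply (open_locally HtX). intros y Hy. destruct (Rle_dec (d x y) (eps / 2)) as [Hle'|Hle'].
    - exists (fun y => U y /\ ~ box (hx x) eta (hx y)). split; [|split].
      + apply (hxc (fun w => ~ box (hx x) eta w)). intros w Hw.
        apply not_all_ex_not in Hw. destruct Hw as [i Hi]. apply Rnot_le_lt in Hi.
        exists (Rabs (w i - hx x i) - eta). split; [lra|]. intros w' Hw' Hb.
        specialize (Hw' i). specialize (Hb i).
        assert (Ht := Rabs_triang (w i - w' i) (w' i - hx x i)).
        replace (w i - w' i + (w' i - hx x i)) with (w i - hx x i) in Ht by ring. lra.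
      + split; [now apply HD|]. intros Hb. apply Hy. split; [now apply HD|auto].
      + intros z [_ Hz] [_ Hz']. auto.
    - exists (fun y => ~ d x y <= eps / 2). split; [exact (closed_ball Hd x (eps / 2))|].
      split; [auto|]. intros z Hz Hz'. auto. }
  assert (Hcomp : compact_set tX (chart_box U hx (hx x) eta)).
  { apply compact_closed_subset with C1; auto. intros y Hy. now apply HOC1, HD, HBD. }
  eexists. eexists. split; [exact Hcomp|]. split.
  - intros y Hy. now apply HD, HBD.
  - apply (chart_box_large HtX Hch eta_pos); auto. intros w Hw. now apply Hbox.
Qed.

(** * Permutations of finite subsets of a discrete space *)

Module Permutations.
Import mathcomp.boot.all_boot mathcomp.fingroup.all_fingroup.
Local Open Scope nat_scope.

Lemma card_fibers (T C : finType) (Q : {set T}) (f : T -> C) :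
  #|Q| = \sum_c #|[set x in Q | f x == c]|.
Proof.
rewrite -sum1_card (partition_big f xpredT) //=; apply: eq_bigr => c _.
by rewrite -sum1_card; apply: eq_bigl => x; rewrite inE.
Qed.

Lemma large_fiber (T C : finType) (Q : {set T}) (f : T -> C) b :
  0 < #|C| -> #|C| * b <= #|Q| -> exists c, b <= #|[set x in Q | f x == c]|.
Proof.
case: b => [|b] C0 leQ; first by case/card_gt0P: C0 => c _; exists c.
apply/existsP; apply: contraLR leQ; rewrite negb_exists => /forallP small.
rewrite -ltnNge (card_fibers Q f).
apply: (@leq_ltn_trans (\sum_(c : C) b)).
  by apply: leq_sum => c _; move: (small c); rewrite -ltnNge ltnS.
by rewrite sum_nat_const ltn_mul2l C0 ltnS leqnn.
Qed.

(** Otherwise every [i] has at most one value [top i] taken by [b] or more members. Counting the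
    place and the value, at most [N * (N * b)] members deviate from [top] somewhere, and at most one
    permutation agrees with [top] everywhere. *)
Lemma two_large_fibers N (Q : {set {perm 'I_N}}) b :
  (N * (N * b)).+1 < #|Q| -> exists i c c', [/\ c != c',
    b <= #|[set p : {perm 'I_N} in Q | p i == c]| & b <= #|[set p : {perm 'I_N} in Q | p i == c']|].
Proof.
move=> ltQ.
have [/existsP[i /existsP[c /existsP[c' /and3P[? ? ?]]]]|/existsPn none] := boolP
  [exists i : 'I_N, exists c : 'I_N, exists c' : 'I_N, [&& c != c',
    b <= #|[set p : {perm 'I_N} in Q | p i == c]| & b <= #|[set p : {perm 'I_N} in Q | p i == c']|]].
  by exists i, c, c'.
pose top (i : 'I_N) := odflt i [pick c | b <= #|[set p : {perm 'I_N} in Q | p i == c]|].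
have small i c : c != top i -> #|[set p : {perm 'I_N} in Q | p i == c]| <= b.
  rewrite /top; case: pickP => [c' big /= ne | nobig _].
    move/existsPn: (none i) => /(_ c) /existsPn /(_ c').
    by rewrite ne big andbT -ltnNge => /ltnW.
  by apply: ltnW; rewrite ltnNge nobig.
pose off i := [set p : {perm 'I_N} in Q | p i != top i].
have off_small i : #|off i| <= N * b.
  rewrite (card_fibers (off i) (fun p : {perm 'I_N} => p i)).
  apply: (@leq_trans (\sum_(c : 'I_N) b)); last by rewrite sum_nat_const card_ord.
  apply: leq_sum => c _.
  case: (eqVneq c (top i)) => [->|ne].
    rewrite (_ : [set x in _ | _] = set0) ?cards0 //.
    by apply/setP => p; rewrite !inE; case: eqP => //; rewrite !andbF.
  apply: leq_trans (small i c ne); apply/subset_leq_card/subsetP => p.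
  by rewrite !inE => /andP[/andP[-> _] ->].
have cover : Q \subset (\bigcup_i off i) :|: [set p : {perm 'I_N} | [forall i, p i == top i]].
  apply/subsetP => p pQ; rewrite !inE.
  case: (boolP [forall i, p i == top i]) => [_|/forallPn[i ne]]; first by rewrite orbT.
  by rewrite orbF; apply/bigcupP; exists i => //; rewrite inE pQ.
have one : #|[set p : {perm 'I_N} | [forall i, p i == top i]]| <= 1.
  rewrite leqNgt; apply/negP => /card_gt1P[p [q [+ + ne]]]; rewrite !inE.
  move=> /forallP hp /forallP hq; case/eqP: ne; apply/permP => i.
  by rewrite (eqP (hp i)) (eqP (hq i)).
have cup : #|\bigcup_i off i| <= N * (N * b).
  apply: (@leq_trans (\sum_(i : 'I_N) N * b)); last by rewrite sum_nat_const card_ord.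
  elim/big_ind2: _ => [|m A n D leA leD|i _]; first by rewrite cards0.
    by apply: leq_trans (leq_add leA leD); rewrite cardsU leq_subr.
  exact: off_small.
move: (leq_trans ltQ (subset_leq_card cover)); rewrite cardsU => lt.
have := leq_trans lt (leq_subr _ _).
by rewrite ltnNge => /negP[]; rewrite -addn1 leq_add.
Qed.

Lemma expn4_gt N : 0 < N -> N * N + 2 <= 4 ^ N.
Proof.
elim: N => // [[|N] IH] _ //.
have {}IH := IH isT; rewrite expnS; apply: leq_trans (_ : 4 * (N.+1 * N.+1 + 2) <= _); last by rewrite leq_mul2l.
have le2 : N.+2 <= 2 * N.+1 by rewrite mulnS addnC addn2 !ltnS leq_pmull.
by rewrite mulnDr leq_add // (_ : 4 = 2 * 2) // mulnACA leq_mul.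
Qed.

Lemma fact_ge c n : c ^ n <= (c + n)`!.
Proof.
elim: n => [|n IH]; first by rewrite expn0 fact_gt0.
by rewrite expnS addnS factS leq_mul // -addnS leq_addr.
Qed.

(** For [c = 16 ^ k] and [N = 2 c] the factorial of [2 c] is at least
    [c ^ c = 16 ^ (k * c) = 4 ^ (N * k)]. *)
Lemma many_permutations k : exists N, 0 < N /\ 4 ^ (N * k) <= #|{perm 'I_N}|.
Proof.
pose c := 16 ^ k; exists (c + c); split; first by rewrite addn_gt0 expn_gt0.
have -> : #|{perm 'I_(c + c)}| = (c + c)`!.
  by rewrite card_Sn.
apply: leq_trans (fact_ge c c).
by rewrite addnn -mul2n -mulnA expnM mulnC expnM.
Qed.

Section Action.
Variables (X : Type) (tX : opens X) (N : nat) (pts : nat -> X).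
Hypothesis tX_discrete : forall U, tX U.
Hypothesis pts_inj : forall i j, pts i = pts j -> i = j.
Hypothesis N_pos : 0 < N.

Definition points (x : X) : Prop := exists i : 'I_N, pts i = x.

Definition act (p : {perm 'I_N}) (x : X) : X :=
  match excluded_middle_informative (points x) with
  | left h => pts (p (proj1_sig (constructive_indefinite_description _ h)))
  | right _ => x
  end.

Lemma act_pts p (i : 'I_N) : act p (pts i) = pts (p i).
Proof.
rewrite /act; case: excluded_middle_informative => [h|[]]; last by exists i.
case: constructive_indefinite_description => j /= /pts_inj ji.
by congr (pts (p _)); apply: val_inj.
Qed.

Lemma act_off p x : ~ points x -> act p x = x.
Proof. by rewrite /act; case: excluded_middle_informative. Qed.

Lemma actK (p q : {perm 'I_N}) : (forall i, q (p i) = i) -> forall x, act q (act p x) = x.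
Proof.
move=> pq x; case: (classic (points x)) => [[i <-]|nx]; first by rewrite !act_pts pq.
by rewrite !(act_off _ nx).
Qed.

Lemma act_supported p : supported tX points (act p, act p^-1%g).
Proof.
split; first by move=> V _; apply: tX_discrete.
split; first by move=> V _; apply: tX_discrete.
split; first by apply: actK => i; rewrite permK.
split; first by apply: actK => i; rewrite permKV.
exact: act_off.
Qed.

Definition mem_bool (A : X -> Prop) (x : X) : bool :=
  if excluded_middle_informative (A x) then true else false.

Lemma mem_boolP A x : reflect (A x) (mem_bool A x).
Proof. by rewrite /mem_bool; case: excluded_middle_informative => h; constructor. Qed.

Lemma permutations_large k (Q : {set {perm 'I_N}}) : 4 ^ (N * k) <= #|Q| ->
  large tX points k (fun r => exists p, p \in Q /\ r = (act p, act p^-1%g)).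
Proof.
elim: k Q => [|k IH] Q leQ.
  split; last by split=> // r [p [_ ->]]; apply: act_supported.
  by move: leQ; rewrite muln0 expn0 => /card_gt0P[p pQ]; exists (act p, act p^-1%g), p.
set b := 4 ^ (N * k) in IH.
have b0 : 0 < b by rewrite expn_gt0.
have {}leQ : 4 ^ N * b <= #|Q| by rewrite -expnD -mulnS.
split; last split; first last.
- split.
  + move=> A A' _ _ dis.
    (* The colour of [p] records which points [p] and its inverse send into [A]. There are [4 ^ N]
       colours, and permutations of one colour agree on membership in [A], which excludes [A']. *)
    pose f (p : {perm 'I_N}) := ([ffun i : 'I_N => mem_bool A (pts (p i))],
                                 [ffun i : 'I_N => mem_bool A (pts (p^-1%g i))]).
    have cC : #|{: {ffun 'I_N -> bool} * {ffun 'I_N -> bool}}| = 4 ^ N.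
      by rewrite card_prod !card_ffun card_bool card_ord -expnMn.
    have [||c leF] := @large_fiber _ _ Q f b; rewrite ?cC ?expn_gt0 //.
    exists (fun r => exists p, p \in [set p in Q | f p == c] /\ r = (act p, act p^-1%g)).
    split; first by move=> r [p [+ ->]]; rewrite inE => /andP[pQ _]; exists p.
    split; first exact: IH.
    move=> r r' x [p [+ ->]] [q [+ ->]] [i <-] /=; rewrite !inE !act_pts.
    move=> /andP[_ /eqP fp] /andP[_ /eqP]; rewrite -fp => -[/ffunP e1 /ffunP e2].
    split=> -[Ai A'i].
      by move: (e1 i); rewrite !ffunE (introT (mem_boolP _ _) Ai) => /mem_boolP Aq; apply: (dis _ (conj Aq A'i)).
    by move: (e2 i); rewrite !ffunE (introT (mem_boolP _ _) Ai) => /mem_boolP Aq; apply: (dis _ (conj Aq A'i)).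
  + have [|i [c [c' [ne bc bc']]]] := @two_large_fibers N Q b.
      (* Since [b] is positive, [4 ^ N * b >= (N * N + 2) * b >= N * N * b + 2]. *)
      apply: leq_trans leQ; have := expn4_gt N_pos; rewrite -(leq_pmul2r b0) => le4.
      apply: leq_trans le4; rewrite mulnDl mulnA -[X in X <= _]addn2 leq_add2l.
      by rewrite -[2 in X in X <= _]muln1 leq_mul2l.
    exists (fun r => exists p, p \in [set p : {perm 'I_N} in Q | p i == c] /\ r = (act p, act p^-1%g)).
    exists (fun r => exists p, p \in [set p : {perm 'I_N} in Q | p i == c'] /\ r = (act p, act p^-1%g)).
    split; first by move=> r [p [+ ->]]; rewrite inE => /andP[pQ _]; exists p.
    split; first by move=> r [p [+ ->]]; rewrite inE => /andP[pQ _]; exists p.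
    split; first exact: IH.
    split; first exact: IH.
    exists (pts i), (fun x => x = pts c), (fun x => x = pts c').
    split; first by exists i.
    split; first exact: tX_discrete.
    split; first exact: tX_discrete.
    split; first by move=> x ->; exists c.
    split; first by move=> x ->; exists c'.
    split; first by move=> x [-> /pts_inj/val_inj e]; rewrite e eqxx in ne.
    split; move=> r [p [+ ->]]; rewrite inE /= act_pts => /andP[_ /eqP -> //].
- by move=> r [p [_ ->]]; apply: act_supported.
- have /card_gt0P[p pQ] : 0 < #|Q| by apply: leq_trans leQ; rewrite muln_gt0 expn_gt0.
  by exists (act p, act p^-1%g), p.
Qed.

End Action.

Lemma discrete_large (X : Type) (tX : opens X) (pts : nat -> X) k :
  (forall U, tX U) -> (forall i j, pts i = pts j -> i = j) ->
  exists N S, large tX (fun x => exists n, (n < N)%coq_nat /\ x = pts n) k S.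
Proof.
move=> disc inj; have [N [N0 leN]] := many_permutations k.
exists N, (fun r => exists p : {perm 'I_N}, p \in [set: {perm 'I_N}] /\ r = (act pts p, act pts p^-1%g)).
have -> : (fun x => exists n, (n < N)%coq_nat /\ x = pts n) = points N pts.
  apply: pred_ext => x; split.
    by move=> [n [/ltP ltn ->]]; exists (Ordinal ltn).
  by move=> [i <-]; exists i; split=> //; apply/ltP.
by apply: permutations_large => //; rewrite cardsT.
Qed.

End Permutations.

(** * The zero-dimensional case *)

Lemma escaping_sequence (X : Type) (tX : opens X) C :
  ~ compact_space tX -> compact_set tX C ->
  exists pts : nat -> X, (forall i j, pts i = pts j -> i = j) /\ forall i, ~ C (pts i).
Proof.
  intros Hnc HC. destruct (noncompact_escapes Hnc HC) as [x0 _].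
  destruct (choice (fun (D : X -> Prop) x => compact_set tX D -> ~ D x)) as [g Hg].
  { intros D. destruct (classic (compact_set tX D)) as [HD|HD].
    - destruct (noncompact_escapes Hnc HD) as [x Hx]. now exists x.
    - exists x0. tauto. }
  set (H := fix H (n : nat) : X -> Prop := match n with
    | 0%nat => C
    | S n => fun x => H n x \/ x = g (H n) end).
  assert (HH : forall n, compact_set tX (H n)).
  { induction n as [|n IH]; [exact HC|]. apply compact_or; [exact IH|apply compact_point]. }
  assert (Hmono : forall n m x, (n <= m)%nat -> H n x -> H m x).
  { intros n m x Hnm Hx. induction Hnm; [auto|]. simpl. auto. }
  assert (Hlt : forall n m, (n < m)%nat -> g (H n) <> g (H m)).
  { intros n m Hnm Heq. apply (Hg (H m) (HH m)). rewrite <- Heq.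
    apply Hmono with (S n); [exact Hnm|]. simpl. auto. }
  exists (fun n => g (H n)). split.
  - intros i j Hij. destruct (Nat.lt_total i j) as [Hl|[Hl|Hl]]; [|auto|]; exfalso.
    + now apply (Hlt i j).
    + now apply (Hlt j i).
  - intros i HCi. apply (Hg (H i) (HH i)). apply Hmono with 0%nat; [lia|auto].
Qed.

(** [Rn 0] has a single point, so the domain of a chart is a singleton. *)
Lemma zero_dimensional_discrete (X : Type) (tX : opens X) :
  is_topology tX -> locally_euclidean tX 0 -> forall U, tX U.
Proof.
  intros HtX Hle U. apply (open_locally HtX). intros x Hx.
  destruct (chart_exists x HtX Hle) as [O [V [hx [hi [[HO [_ [Hxi _]]] HOx]]]]].
  exists O. split; [auto|]. split; [auto|]. intros y Hy.
  replace y with x; [auto|]. rewrite <- (proj2 (Hxi x HOx)), <- (proj2 (Hxi y Hy)).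
  f_equal. apply functional_extensionality. intros i. apply (Fin.case0 (fun _ => _) i).
Qed.

Lemma discrete_gadget (X : Type) (tX : opens X) :
  is_topology tX -> locally_euclidean tX 0 -> ~ compact_space tX ->
  forall k C, compact_set tX C -> exists B S,
    compact_set tX B /\ (forall x, B x -> ~ C x) /\ large tX B k S.
Proof.
  intros HtX Hle Hnc k C HC.
  destruct (escaping_sequence Hnc HC) as [pts [Hinj HptsC]].
  destruct (Permutations.discrete_large k (zero_dimensional_discrete HtX Hle) Hinj) as [N [S HS]].
  exists (fun x => exists n, (n < N)%nat /\ x = pts n), S. split; [|split; [|exact HS]].
  - apply (compact_bounded_union (A := fun n x => x = pts n)). intros n _. apply compact_point.
  - intros x [n [_ ->]]. apply HptsC.
Qed.

(** * Well-ordering the continuum *)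

Module WellOrder.
Import mathcomp.boot.all_boot mathcomp.classical.boolp mathcomp.classical.wochoice.

(** The library principle gives a relation with unique minima in nonempty sets. Reflexivity and
    antisymmetry come from sets of one and two points, transitivity from sets of three, and the
    strict part is taken. *)
Lemma well_order_exists (T : Type) : exists lt : T -> T -> Prop,
  well_founded lt /\ (forall a b c, lt a b -> lt b c -> lt a c) /\
  (forall a b, lt a b \/ a = b \/ lt b a).
Proof.
have [R wo] := well_ordering_principle {classic T}.
have min (P : T -> Prop) : (exists x, P x) ->
    exists z, P z /\ forall x, P x -> R z x.
  move=> [x Px].
  have [|z [[zP lbz] _]] := wo [pred x : {classic T} | `[< P x >]].
    by exists x; rewrite inE; apply/asboolP.
  exists z; split; first by move: zP; rewrite inE => /asboolP.
  by move=> y Py; apply: lbz; rewrite inE; apply/asboolP.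
have anti x y : R x y -> R y x -> x = y.
  move=> Rxy Ryx; have [|z [_ uniq]] := wo [pred u : {classic T} | `[< u = x \/ u = y >]].
    by exists x; rewrite inE; apply/asboolP; left.
  have refl u : R u u.
    by have [v [uv minv]] := min (eq u) (ex_intro _ u erefl); rewrite {1}uv; apply: minv.
  rewrite -(uniq x) ?(uniq y) //.
    split; first by rewrite inE; apply/asboolP; right.
    by move=> u; rewrite inE => /asboolP[->|->].
  split; first by rewrite inE; apply/asboolP; left.
  by move=> u; rewrite inE => /asboolP[->|->].
exists (fun x y => R x y /\ x <> y); split; [|split].
- move=> a; apply: contrapT => na.
  have [z [nz minz]] := min (fun x => ~ Acc (fun x y => R x y /\ x <> y) x) (ex_intro _ a na).
  apply: nz; constructor => y [Ryz ne]; apply: contrapT => ny.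
  by apply: ne; apply: anti => //; apply: minz.
- move=> a b c [Rab ab] [Rbc bc].
  have ac : a <> c by move=> e; subst c; apply: ab; apply: anti.
  have [|z [[->|[->|->]] minz]] := min (fun u => u = a \/ u = b \/ u = c).
  + by exists a; left.
  + by split=> //; apply: minz; right; right.
  + by case: ab; apply: anti => //; apply: minz; left.
  + by case: bc; apply: anti => //; apply: minz; right; left.
- move=> a b; case: (pselect (a = b)) => [ab|ab]; first by right; left.
  have [|z [[->|->] minz]] := min (fun u => u = a \/ u = b); first by exists a; left.
    by left; split=> //; apply: minz; right.
  by right; right; split; [apply: minz; left|apply: nesym].
Qed.

End WellOrder.

Lemma enumerate (T : Type) (P : T -> Prop) (t0 : T) :
  (exists f : {x | P x} -> nat, forall a a', f a = f a' -> a = a') ->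
  exists u : nat -> T, forall b, P b -> exists n, u n = b.
Proof.
  intros [f Hf].
  destruct (choice (fun n b => forall b' (H : P b'), f (exist _ b' H) = n -> b' = b)) as [u Hu].
  { intros n. destruct (classic (exists b (H : P b), f (exist _ b H) = n)) as [[b [H Hb]]|Hn].
    - exists b. intros b' H' Hb'. rewrite <- Hb in Hb'. apply Hf in Hb'. now inversion Hb'.
    - exists t0. intros b' H' Hb'. exfalso. apply Hn. now exists b', H'. }
  exists u. intros b Hb. exists (f (exist _ b Hb)). symmetry. now apply (Hu _ b Hb).
Qed.

(** In a well-order of [nat -> bool] with an uncountable initial segment, the least such segment
    replaces the whole set: its own initial segments are countable, and by CH it still has the size
    of the continuum. *)
Lemma continuum_hypothesis_order : CH ->
  exists (I : Type) (lt : I -> I -> Prop) (c : I -> nat -> bool),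
    inhabited I /\ well_founded lt /\ (forall x y z, lt x y -> lt y z -> lt x z) /\
    (forall x y, lt x y \/ x = y \/ lt y x) /\
    (forall a, exists u : nat -> I, forall b, lt b a -> exists n, u n = b) /\
    (forall y, exists a, c a = y).
Proof.
  intros HCH. destruct (WellOrder.well_order_exists (nat -> bool)) as [lt [Hwf [Htr Htot]]].
  set (cnt := fun a => exists f : {x | lt x a} -> nat, forall a a', f a = f a' -> a = a').
  destruct (classic (forall a, cnt a)) as [Hall|Hn].
  - exists (nat -> bool), lt, (fun y => y). split; [constructor; exact (fun _ => true)|].
    split; [auto|]. split; [auto|]. split; [auto|]. split.
    + intros a. apply enumerate; [exact a|apply Hall].
    + intros y. now exists y.
  - assert (Hmin : exists a, ~ cnt a /\ forall b, lt b a -> cnt b).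
    { apply NNPP. intros Hm. apply Hn. intros a. induction (Hwf a) as [a _ IH].
      apply NNPP. intros Ha. apply Hm. now exists a. }
    destruct Hmin as [a [Ha Hb]].
    destruct (HCH (fun x => lt x a)) as [Hc|[c [_ Hc]]]; [tauto|].
    assert (Hinj : forall x y : {x | lt x a}, proj1_sig x = proj1_sig y -> x = y).
    { intros [x Hx] [y Hy]. simpl. intros <-. f_equal. apply proof_irrelevance. }
    exists {x | lt x a}, (fun x y => lt (proj1_sig x) (proj1_sig y)), c.
    split; [|split; [|split; [|split; [|split]]]].
    + destruct (Hc (fun _ => true)) as [x _]. now constructor.
    + now apply wf_inverse_image.
    + intros x y z. apply Htr.
    + intros x y. destruct (Htot (proj1_sig x) (proj1_sig y)) as [|[|]]; auto.
    + intros x. apply enumerate; [exact x|].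
      destruct (Hb (proj1_sig x) (proj2_sig x)) as [f Hf].
      exists (fun y => f (exist (fun z => lt z (proj1_sig x)) (proj1_sig (proj1_sig y)) (proj2_sig y))).
      intros [y Hy] [z Hz] Hyz. apply Hf in Hyz. simpl in Hyz.
      assert (Hyz' : y = z) by (apply Hinj; now inversion Hyz). subst z.
      f_equal. apply proof_irrelevance.
    + exact Hc.
Qed.

(** * Cardinalities *)

(** [C] holds of the points whose backward orbit ends outside the range of [g]; [f] is used there,
    the inverse of [g] elsewhere. *)
Lemma cantor_bernstein (A B : Type) (f : A -> B) (g : B -> A) :
  (forall a a', f a = f a' -> a = a') -> (forall b b', g b = g b' -> b = b') -> equipotent A B.
Proof.
  intros Hf Hg.
  set (it := fun n => Nat.iter n (fun a => g (f a))).
  set (C := fun a => exists n a0, (forall b, g b <> a0) /\ it n a0 = a).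
  destruct (choice (fun a b => (C a -> b = f a) /\ (~ C a -> g b = a))) as [h Hh].
  { intros a. destruct (classic (C a)) as [Ha|Ha].
    - exists (f a). tauto.
    - destruct (classic (exists b, g b = a)) as [[b Hb]|Hb].
      + exists b. tauto.
      + exfalso. apply Ha. exists 0%nat, a. split; [|reflexivity]. intros b Hgb. apply Hb. now exists b. }
  assert (HC : forall a, C a -> C (g (f a))).
  { intros a [n [a0 [H0 <-]]]. exists (S n), a0. split; [auto|reflexivity]. }
  exists h. split.
  - intros a a' Heq. destruct (Hh a) as [H1 H2], (Hh a') as [H3 H4].
    destruct (classic (C a)) as [Ha|Ha], (classic (C a')) as [Ha'|Ha'].
    + apply Hf. now rewrite <- H1, <- H3.
    + exfalso. apply Ha'. rewrite <- (H4 Ha'), <- Heq, (H1 Ha). now apply HC.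
    + exfalso. apply Ha. rewrite <- (H2 Ha), Heq, (H3 Ha'). now apply HC.
    + now rewrite <- (H2 Ha), <- (H4 Ha'), Heq.
  - intros b. destruct (classic (C (g b))) as [Hb|Hb].
    + destruct Hb as [[|n] [a0 [H0 Hn]]].
      * exfalso. now apply (H0 b).
      * simpl in Hn. apply Hg in Hn. exists (it n a0). rewrite <- Hn. apply Hh. now exists n, a0.
    + exists (g b). apply Hg. now apply Hh.
Qed.

Lemma cantor_no_injection (A : Type) (j : (A -> bool) -> A) :
  ~ forall h h', j h = j h' -> h = h'.
Proof.
  intros Hj.
  set (D := fun y => if excluded_middle_informative (exists h, j h = y /\ h y = false)
    then true else false).
  assert (HD : D (j D) = true <-> exists h, j h = j D /\ h (j D) = false).
  { unfold D at 1. destruct (excluded_middle_informative _); split; auto; discriminate. }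
  destruct (D (j D)) eqn:E.
  - destruct (proj1 HD eq_refl) as [h [H1 H2]]. apply Hj in H1. subst h. congruence.
  - assert (H : false = true); [|discriminate]. apply HD. now exists D.
Qed.

(** * Coding closed sets and maps by points of Cantor space *)

Definition to_bool (P : Prop) : bool := if excluded_middle_informative P then true else false.

Lemma to_bool_true P : to_bool P = true <-> P.
Proof. unfold to_bool. destruct (excluded_middle_informative P); split; auto; discriminate. Qed.

Definition evens (y : nat -> bool) : nat -> bool := fun n => y (2 * n)%nat.
Definition odds (y : nat -> bool) : nat -> bool := fun n => y (S (2 * n)).

Lemma interleave (a b : nat -> bool) : exists y, evens y = a /\ odds y = b.
Proof.
  exists (fun n => if Nat.even n then a (Nat.div2 n) else b (Nat.div2 n)).
  split; apply functional_extensionality; intros n; unfold evens, odds.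
  - rewrite Nat.even_mul, Nat.div2_double. reflexivity.
  - rewrite Nat.even_succ, Nat.odd_mul, Nat.div2_succ_double. reflexivity.
Qed.

Section Codes.
Variables (X : Type) (tX : opens X) (d : X -> X -> R) (s : nat -> X).
Hypothesis Hd : is_metric_for tX d.
Hypothesis Hs : dense tX (fun x => exists k, s k = x).

Definition basic_ball (n : nat) (x : X) : Prop :=
  d (s (fst (of_nat n))) x < / INR (S (snd (of_nat n))).

Lemma basic_ball_base x eps : 0 < eps ->
  exists n, basic_ball n x /\ forall z, basic_ball n z -> d x z < eps.
Proof.
  intros He. destruct (dense_ball Hd Hs x He) as [i [m [H1 H2]]].
  exists (to_nat (i, m)). unfold basic_ball. now rewrite cancel_of_to.
Qed.

(** [y] names the basic balls to be removed; a closed set arises by naming all the balls that miss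
    it. *)
Definition decode (y : nat -> bool) (x : X) : Prop := forall n, y n = true -> ~ basic_ball n x.

Lemma decode_closed_set A : closed tX A -> exists y, decode y = A.
Proof.
  intros HA. exists (fun n => to_bool (forall x, A x -> ~ basic_ball n x)).
  apply pred_ext. intros x. split.
  - intros Hx. apply NNPP. intros Hn.
    destruct (proj1 (proj2 (proj2 (proj2 (proj2 Hd))) _) HA x Hn) as [eps [He HeA]].
    destruct (basic_ball_base x He) as [n [H1 H2]].
    apply (Hx n); [|auto]. apply to_bool_true. intros z Hz Hb. exact (HeA z (H2 z Hb) Hz).
  - intros Hx n Hn. apply -> to_bool_true in Hn. exact (Hn x Hx).
Qed.

Definition decode_pair (y : nat -> bool) : (X -> Prop) * (X -> Prop) :=
  (decode (evens y), decode (odds y)).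

Lemma decode_pair_surjective A : closed_disjoint tX A -> exists y, decode_pair y = A.
Proof.
  destruct A as [A A']. intros [HA [HA' _]]. simpl in *.
  destruct (decode_closed_set HA) as [a <-]. destruct (decode_closed_set HA') as [a' <-].
  destruct (interleave a a') as [y [<- <-]]. now exists y.
Qed.

(** The table of the basic balls that contain the values on the dense sequence; it pins down these
    values and thereby a continuous map. *)
Definition encode_map (f : X -> X) : nat -> bool :=
  fun n => to_bool (basic_ball (snd (of_nat n)) (f (s (fst (of_nat n))))).

Lemma encode_map_injective f g : continuous tX tX f -> continuous tX tX g ->
  encode_map f = encode_map g -> f = g.
Proof.
  intros Hf Hg Heq. apply functional_extensionality. intros x. apply NNPP. intros Hn.
  destruct (metric_hausdorff Hd Hn) as [U [V [HU [HV [HUx [HVx Hdis]]]]]].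
  destruct (Hs (U := fun z => U (f z) /\ V (g z))) as [z [[Hz1 Hz2] [k <-]]].
  - apply (open_inter (metric_topology Hd)); [exact (Hf U HU)|exact (Hg V HV)].
  - now exists x.
  - destruct (proj1 (proj2 (proj2 (proj2 (proj2 Hd))) U) HU _ Hz1) as [eps [He HeU]].
    destruct (basic_ball_base (f (s k)) He) as [n [H1 H2]].
    assert (H3 : encode_map f (to_nat (k, n)) = true).
    { unfold encode_map. rewrite cancel_of_to. now apply to_bool_true. }
    rewrite Heq in H3. unfold encode_map in H3. rewrite cancel_of_to in H3.
    apply -> to_bool_true in H3. apply (Hdis (g (s k))). split; [|auto]. apply HeU, H2, H3.
Qed.

Variables (K : Type) (tK : opens K) (e : X -> K).
Hypothesis Hsc : is_StoneCech tX tK e.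

(** For [y] the trace of an open [U] on the dense sequence this set lies between [U] and
    [closure U], so continuum many sets stand in for all open sets of [K]. *)
Definition trace_closure (y : nat -> bool) : K -> Prop :=
  closure tK (fun p => exists n, y n = true /\ e (s n) = p).

Lemma trace_closure_open U p : tK U -> U p -> trace_closure (fun n => to_bool (U (e (s n)))) p.
Proof.
  intros HU Hp W HW HWp.
  destruct Hsc as [HtK [_ [_ [[He _] [Hden _]]]]].
  assert (HUW : tK (fun q => U q /\ W q)) by now apply open_inter.
  destruct (Hden _ HUW) as [q [Hq [x <-]]]; [now exists p|].
  destruct (Hs (U := fun x => U (e x) /\ W (e x))) as [z [[Hz1 Hz2] [k <-]]].
  - exact (He _ HUW).
  - now exists x.
  - exists (e (s k)). split; [auto|]. exists k. split; [now apply to_bool_true|auto].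
Qed.

Lemma trace_closure_incl U p : trace_closure (fun n => to_bool (U (e (s n)))) p -> closure tK U p.
Proof.
  intros Hp W HW HWp. destruct (Hp W HW HWp) as [q [Hq [n [Hn <-]]]].
  exists (e (s n)). split; [auto|]. now apply to_bool_true.
Qed.

Definition encode_homeo (phi : Xstar e -> Xstar e) (y : nat -> bool) : bool :=
  to_bool (forall p, trace_closure (evens y) (proj1_sig p) -> trace_closure (odds y) (proj1_sig (phi p))).

Lemma Xstar_eq (p q : Xstar e) : proj1_sig p = proj1_sig q -> p = q.
Proof. destruct p as [p Hp], q as [q Hq]. simpl. intros <-. f_equal. apply proof_irrelevance. Qed.

(** If [phi] and [psi] differ at [p], then [phi] carries a neighbourhood of [p] into a [V] whose
    closure misses a neighbourhood of the value of [psi]. The code of [phi] records this inclusion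
    for traces, and an equal code would put the value of [psi] into [closure V]. *)
Lemma encode_homeo_injective phi psi :
  continuous (Xstar_top tK e) (Xstar_top tK e) phi ->
  encode_homeo phi = encode_homeo psi -> phi = psi.
Proof.
  intros Hphi Heq. apply functional_extensionality. intros p. apply Xstar_eq. apply NNPP. intros Hn.
  assert (HtK := proj1 Hsc). assert (HcK := proj1 (proj2 Hsc)). assert (HhK := proj1 (proj2 (proj2 Hsc))).
  destruct (HhK _ _ Hn) as [V [V' [HV [HV' [HVp [HVp' Hdis]]]]]].
  destruct (Hphi (fun q => V (proj1_sig q))) as [W [HW HWV]].
  { exists V. split; [auto|tauto]. }
  assert (HWp : W (proj1_sig p)) by now apply HWV.
  destruct (compact_hausdorff_regular HtK HcK HhK HW HWp) as [U [HU [HUp HUW]]].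
  destruct (interleave (fun n => to_bool (U (e (s n)))) (fun n => to_bool (V (e (s n)))))
    as [y [Hy1 Hy2]].
  assert (H1 : encode_homeo phi y = true).
  { apply to_bool_true. rewrite Hy1, Hy2. intros q Hq. apply trace_closure_open; [auto|].
    apply HWV, HUW. now apply trace_closure_incl. }
  rewrite Heq in H1. apply -> to_bool_true in H1.
  specialize (H1 p). rewrite Hy1, Hy2 in H1.
  assert (H2 := trace_closure_incl (H1 (trace_closure_open HU HUp))).
  destruct (H2 V' HV' HVp') as [q [Hq1 Hq2]]. now apply (Hdis q).
Qed.

(** A map [f] inducing a trivial homeomorphism determines it, because the extension of [f] to [K] is
    unique by density; so choosing [f] and applying [encode_map] is injective. *)
Lemma trivial_homeo_map : exists t : {phi : Xstar e -> Xstar e | trivial_homeo tX tK e phi} -> nat -> bool,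
  forall phi psi, t phi = t psi -> phi = psi.
Proof.
  destruct (choice (fun (phi : {phi : Xstar e -> Xstar e | trivial_homeo tX tK e phi}) f =>
    continuous tX tX f /\ exists g : K -> K, continuous tK tK g /\
      (forall x, g (e x) = e (f x)) /\ (forall p, g (proj1_sig p) = proj1_sig (proj1_sig phi p))))
    as [F HF].
  { intros [phi Hphi]. exact Hphi. }
  exists (fun phi => encode_map (F phi)). intros phi psi Heq.
  destruct (HF phi) as [Hf [g [Hg1 [Hg2 Hg3]]]]. destruct (HF psi) as [Hf' [g' [Hg1' [Hg2' Hg3']]]].
  apply encode_map_injective in Heq; [|auto|auto].
  assert (Hpq : proj1_sig phi = proj1_sig psi).
  { apply functional_extensionality. intros p. apply Xstar_eq. rewrite <- Hg3, <- Hg3'.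
    apply (dense_eq Hsc); auto. intros x. now rewrite Hg2, Hg2', Heq. }
  destruct phi as [phi H], psi as [psi H']. simpl in Hpq. subst psi. f_equal. apply proof_irrelevance.
Qed.

End Codes.

Unset Implicit Arguments.

Theorem theoremA :
  CH ->
  forall (X : Type) (tX : opens X) (n : nat),
    is_topology tX -> metrizable tX -> separable tX -> locally_compact tX ->
    locally_euclidean tX n -> ~ compact_space tX ->
  forall (K : Type) (tK : opens K) (e : X -> K),
    is_StoneCech tX tK e ->
    equipotent
      {phi : Xstar e -> Xstar e | homeomorphism (Xstar_top tK e) (Xstar_top tK e) phi}
      ((nat -> bool) -> bool)
    /\ exists phi : Xstar e -> Xstar e,
         homeomorphism (Xstar_top tK e) (Xstar_top tK e) phi /\ ~ trivial_homeo tX tK e phi.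
Proof.
  intros HCH X tX n HtX [d Hd] Hsep Hlc Hle Hnc K tK e Hsc.
  change (is_metric_for tX d) in Hd.
  assert (Hgad : forall k C, compact_set tX C -> exists B S,
    compact_set tX B /\ (forall x, B x -> ~ C x) /\ large tX B k S).
  { destruct n as [|m].
    - now apply discrete_gadget.
    - now apply (manifold_gadget Hd (m := m)). }
  destruct (discrete_gadgets Hd Hsep Hlc Hgad) as [B [HBc [HBd HBg]]].
  destruct (continuum_hypothesis_order HCH) as [I [lt [c [Hinh [Hwf [Htr [Htot [Hcnt Hc]]]]]]]].
  destruct Hsep as [s Hs].
  destruct (tower_homeomorphisms (code := fun a => decode_pair d s (c a)) Hd Hlc Hsc HBc HBd HBg
    Hinh Hwf Htr Htot Hcnt) as [Psi HPsi].
  { intros A HA. destruct (decode_pair_surjective Hd Hs HA) as [y Hy].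
    destruct (Hc y) as [a Ha]. exists a. now rewrite Ha. }
  set (lower := fun h : (nat -> bool) -> bool => Psi (fun a => h (c a))).
  assert (Hlower : forall h h', lower h = lower h' -> h = h').
  { intros h h' Hh. apply HPsi in Hh. apply functional_extensionality. intros y.
    destruct (Hc y) as [a <-]. exact (f_equal (fun k => k a) Hh). }
  split.
  - apply (cantor_bernstein (f := fun phi => encode_homeo s tK (proj1_sig phi)) (g := lower)); [|auto].
    intros [phi Hphi] [psi Hpsi] Heq. simpl in Heq.
    apply (encode_homeo_injective Hs Hsc) in Heq; [|apply Hphi].
    subst psi. f_equal. apply proof_irrelevance.
  (* Were all homeomorphisms trivial, [lower] followed by the coding of trivial ones would inject
     [(nat -> bool) -> bool] into [nat -> bool], against Cantor. *)
  - apply NNPP. intros Hn.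
    assert (Htriv : forall phi, homeomorphism (Xstar_top tK e) (Xstar_top tK e) phi -> trivial_homeo tX tK e phi).
    { intros phi Hphi. apply NNPP. intros Ht. apply Hn. now exists phi. }
    destruct (trivial_homeo_map Hd Hs Hsc) as [t Ht].
    apply (@cantor_no_injection _ (fun h => t (exist _ (proj1_sig (lower h)) (Htriv _ (proj2_sig (lower h)))))).
    intros h h' Hh. apply Ht in Hh. apply Hlower.
    apply (f_equal (@proj1_sig _ _)) in Hh. simpl in Hh.
    destruct (lower h) as [phi H1], (lower h') as [psi H2]. simpl in Hh. subst psi.
    f_equal. apply proof_irrelevance.
Qed.
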